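(* Let $X$ be a smooth complex projective variety of dimension $n$. Then $\operatorname{msdim}X\ge 3n$.
   Context: All varieties are over $\mathbb{C}$. For a smooth projective variety $X\subset\mathbb{P}^N$ and $x\in X$, $T_{x,X}\subset\mathbb{P}^N$ denotes the embedded projective tangent space. $X\subset\mathbb{P}^N$ is called skew if $T_{x,X}\cap T_{y,X}=\emptyset$ for any two distinct points $x,y\in X$. Algebraic skewness is a strengthening of skewness that also excludes ''infinitesimal nonskewness''. For an $n$-dimensional smooth $X\subset\mathbb{P}^N$, with $V=H^0(\mathbb{P}^N,\mathcal{O}(1))$ the $(N+1)$-dimensional space of linear forms, $X$ is algebraically skew if its length $2$ Terracini locus is empty, i.e. there is no length $2$ zero-dimensional subscheme $S\subset X$ with $\dim V(-2S)>\dim V-2n-2$, where $2S\subset X$ is the subscheme with ideal $\mathcal{I}_S^2$ and $V(-2S)\subset V$ is the subspace of forms whose restriction to $X$ vanishes on $2S$. (For reduced $S=\{x,y\}$ this says $T_{x,X}\cap T_{y,X}=\emptyset$. For curves, it says $X$ is skew and, for every point and every local lifting $f$ of $X$ to $\mathbb{C}^{N+1}$ at that point, $f(0),f'(0),f''(0),f'''(0)$ are linearly independent.) $\operatorname{msdim}X:=\min\{N:\text{there exists an algebraically skew embedding }X\hookrightarrow\mathbb{P}^N\}$. *)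

(* Defs.v *)
From HB Require Import structures.
From mathcomp Require Import all_boot all_order all_algebra.
From mathcomp Require Import mpoly complex.
From mathcomp Require Import boolp classical_sets reals.

Set Implicit Arguments.
Unset Strict Implicit.
Unset Printing Implicit Defensive.

Import Order.TTheory GRing.Theory Num.Theory.
Local Open Scope ring_scope.
Local Open Scope complex_scope.
Local Open Scope classical_set_scope.

(* The field of complex numbers is R[i], for R any model of the real numbers.
   A point of P^N is represented by its homogeneous coordinates, a nonzero row
   vector x : 'rV_(N.+1); two nonzero vectors are the same point when they are
   proportional.  A subset of P^N is represented by the set of all the
   homogeneous coordinate vectors of its points. *)

Section ProjectiveGeometry.
Variable R : realType.
Local Notation C := R[i].

Definition hcoord (N : nat) : Type := 'rV[C]_N.+1.

Definition form (N : nat) : Type := {mpoly C[N.+1]}.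

Definition same_point N (x y : hcoord N) : Prop :=
  exists2 c : C, c != 0 & y = c *: x.

Definition peval N (p : form N) (x : hcoord N) : C := p.@[x ord0].

Definition zariski_closed N (X : set (hcoord N)) : Prop :=
  exists2 A : set (form N),
    (forall p, A p -> exists d, p \is d.-homog) &
    X = [set x | x != 0 /\ forall p, A p -> peval p x = 0].

Definition irreducible_set N (X : set (hcoord N)) : Prop :=
  X !=set0 /\
  forall Y Z : set (hcoord N), zariski_closed Y -> zariski_closed Z ->
    X `<=` Y `|` Z -> X `<=` Y \/ X `<=` Z.

Definition projective_variety N (X : set (hcoord N)) : Prop :=
  zariski_closed X /\ irreducible_set X.

Definition has_variety_chain N (X : set (hcoord N)) (k : nat) : Prop :=
  exists Z : nat -> set (hcoord N),
    (forall i, (i <= k)%N -> projective_variety (Z i) /\ Z i `<=` X) /\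
    (forall i, (i < k)%N -> Z i `<` Z i.+1).

(* Krull dimension *)
Definition has_dim N (X : set (hcoord N)) (n : nat) : Prop :=
  has_variety_chain X n /\ ~ has_variety_chain X n.+1.

Definition vanishing_ideal N (X : set (hcoord N)) : set (form N) :=
  [set p | forall x, X x -> peval p x = 0].

(* Affine cone over the embedded projective tangent space T_{x,X}. *)
Definition tangent_cone N (X : set (hcoord N)) (x : hcoord N) :
    set (hcoord N) :=
  [set v | forall p, vanishing_ideal X p ->
             \sum_(i < N.+1) peval p^`M(i) x * v ord0 i = 0].

(* Jacobian criterion: T_{x,X} has projective dimension n = dim X, that is,
   the cone over it is a linear space of dimension n + 1. *)
Definition smooth_variety N (X : set (hcoord N)) (n : nat) : Prop :=
  [/\ projective_variety X, has_dim X n &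
      forall x, X x -> exists2 T : {vspace 'rV[C]_N.+1},
        \dim T = n.+1 & forall v, v \in T <-> tangent_cone X x v].

(* Regular maps X -> P^N, given on homogeneous coordinates: near every point
   x of X, on the basic open set where g does not vanish, the map is given by
   N + 1 forms of the same degree without common zero. That f is nonzero on X
   and compatible with same_point follows. *)
Definition regular_map M N (X : set (hcoord M)) (f : hcoord M -> hcoord N) :
    Prop :=
  forall x, X x ->
    exists (g : form M) (F : 'I_N.+1 -> form M) (e d : nat),
      [/\ g \is e.-homog, (forall i, F i \is d.-homog), peval g x != 0 &
          forall y, X y -> peval g y != 0 ->
            let Fy : hcoord N := \row_i peval (F i) y in
            Fy != 0 /\ same_point Fy (f y)].

Definition point_image M N (X : set (hcoord M)) (f : hcoord M -> hcoord N) :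
    set (hcoord N) :=
  [set y | exists2 x, X x & same_point (f x) y].

(* An isomorphism of X onto a closed subset of P^N. *)
Definition embedding M N (X : set (hcoord M)) (f : hcoord M -> hcoord N) :
    Prop :=
  [/\ regular_map X f, zariski_closed (point_image X f) &
      exists2 g : hcoord N -> hcoord M,
        regular_map (point_image X f) g &
        forall x, X x -> same_point (g (f x)) x].

Definition is_ideal N (J : set (form N)) : Prop :=
  [/\ J 0, (forall p q, J p -> J q -> J (p + q)) &
      forall p q, J q -> J (p * q)].

Definition is_homogeneous N (J : set (form N)) : Prop :=
  forall p d, J p -> J (pihomog mdeg d p).

Definition saturation N (J : set (form N)) : set (form N) :=
  [set p | exists k, forall q : form N, q \is k.-homog -> J (q * p)].

(* Closed subschemes of P^N correspond to saturated homogeneous ideals. *)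
Record closed_subscheme (N : nat) := ClosedSubscheme {
  sideal : set (form N);
  sideal_ideal : is_ideal sideal;
  sideal_homogeneous : is_homogeneous sideal;
  sideal_saturated : saturation sideal `<=` sideal }.

(* The value at d of the Hilbert function: the dimension of the degree d part
   of the quotient of the polynomial ring by J is r. *)
Definition hilbert_function N (J : set (form N)) (d r : nat) : Prop :=
  exists2 W : {vspace dhomog N.+1 C d},
    forall p : dhomog N.+1 C d, p \in W <-> J (p : form N) &
    (\dim W + r)%N = \dim {: dhomog N.+1 C d}.

(* Zero-dimensional of length l: the Hilbert polynomial is the constant l. *)
Definition has_length N (S : closed_subscheme N) (l : nat) : Prop :=
  exists d0, forall d, (d0 <= d)%N -> hilbert_function (sideal S) d l.

Definition subscheme_of N (S : closed_subscheme N) (X : set (hcoord N)) :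
    Prop :=
  vanishing_ideal X `<=` sideal S.

Definition ideal_square N (J : set (form N)) : set (form N) :=
  [set p | exists (k : nat) (a b : 'I_k -> form N),
     (forall i, J (a i) /\ J (b i)) /\ p = \sum_(i < k) a i * b i].

(* The saturated ideal, in the coordinate ring of P^N, of the subscheme 2S of
   X whose ideal sheaf in O_X is the square of that of S. *)
Definition double_ideal N (X : set (hcoord N)) (S : closed_subscheme N) :
    set (form N) :=
  saturation [set p | exists q r : form N,
    [/\ ideal_square (sideal S) q, vanishing_ideal X r & p = q + r]].

(* V = H^0(P^N, O(1)) *)
Definition linear_forms (N : nat) : vectType C := dhomog N.+1 C 1.

(* W = V(-2S) *)
Definition forms_vanishing_on_double N (X : set (hcoord N))
    (S : closed_subscheme N) (W : {vspace linear_forms N}) : Prop :=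
  forall l : dhomog N.+1 C 1, l \in W <-> double_ideal X S (l : form N).

(* The inequality dim V(-2S) > dim V - 2n - 2 is written without subtraction,
   since its right-hand side may be negative. *)
Definition in_terracini2 N (X : set (hcoord N)) (n : nat)
    (S : closed_subscheme N) : Prop :=
  [/\ has_length S 2, subscheme_of S X &
      exists2 W : {vspace linear_forms N}, forms_vanishing_on_double X S W &
        (\dim {: linear_forms N} < \dim W + (2 * n + 2))%N].

Definition algebraically_skew N (X : set (hcoord N)) : Prop :=
  exists2 n, smooth_variety X n & ~ exists S, in_terracini2 X n S.

Definition has_algebraically_skew_embedding M (X : set (hcoord M)) (N : nat) :
    Prop :=
  exists2 f : hcoord M -> hcoord N,
    embedding X f & algebraically_skew (point_image X f).

(* msdim X = m *)
Definition is_msdim M (X : set (hcoord M)) (m : nat) : Prop :=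
  has_algebraically_skew_embedding X m /\
  forall N, has_algebraically_skew_embedding X N -> (m <= N)%N.

End ProjectiveGeometry.

(* Main.v *)
From HB Require Import structures.
From mathcomp Require Import all_boot all_order all_algebra.
From mathcomp Require Import mpoly complex.
From mathcomp Require Import boolp classical_sets cardinality reals.
From mathcomp Require Import ring lra zify.
Require Import Defs.

(** Only the third-order behaviour of the image Y of X at one point matters.

    Let x be a point of Y in P^N and T its embedded tangent space.  In the affine
    chart l0 = 1, let t_1..t_n be coordinates along T and s_1..s_k, k = N - n,
    the linear forms vanishing on T.  Since the s_j are differentials of equations
    of Y, on Y near x each s_j is a quadratic form plus a cubic form in t, up to
    terms of order four (normal_expansion).  For a tangent direction v let M(v) be
    the (n+1) x k matrix with rows II(v,e_1), .., II(v,e_n), where II is the second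
    fundamental form, and the cubic term c(v,v,v).

    Let S be the subscheme of length two at x in the direction v.  In coordinates
    with first axis v, the functions on its doubling 2S are spanned by the 2n + 2
    monomials 1, t_1, .., t_n, t_1^2, t_1 t_2, .., t_1 t_n, t_1^3.
    A combination of the s_j whose coefficients are in the kernel of M(v) therefore
    vanishes on 2S (osculating_membership).  If M(v) has rank at most n, there are
    at least k - n such combinations, and dim V - dim V(-2S) <= 2n + 1: S lies in
    the Terracini locus.

    It remains to find v when N < 3n, that is, when k <= 2n - 1.  The rows of M are
    forms of positive degrees in v, and the locus where a matrix of n + 1 rows and
    k columns drops rank has expected codimension k - n <= n - 1 in P^(n-1), so it
    is not empty (determinantal_locus_nonempty).  The proof of this counts
    monomials.  If the rank never dropped, the Nullstellensatz would make a
    suitable algebra of bihomogeneous polynomials in v and a vector y of row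
    coefficients finite over the k polynomials y M(v), whereas its graded pieces
    grow too fast for that.

    The Nullstellensatz is proved by the classical cardinality argument: an
    uncountable algebraically closed field has no proper extension field of
    countable dimension.

    Finally, the dimension in the definition of skewness is that of the image Y;
    it is equal to n since an embedding transports chains of closed irreducible
    subsets (embedding_dim). *)

Set Implicit Arguments.
Unset Strict Implicit.
Unset Printing Implicit Defensive.

Import Order.TTheory GRing.Theory Num.Theory.
Local Open Scope ring_scope.
Local Open Scope complex_scope.
Local Open Scope classical_set_scope.

(** * Uncountability of the reals *)

Section Uncountable.
Variable R : realType.

(** Cantor's nested intervals: the n-th step keeps a third of the interval that
    avoids f n. *)
Lemma real_not_enumerable (f : nat -> R) : exists x, forall n, f n != x.
Proof.
pose nxt (n : nat) (I : R * R) : R * R :=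
  let d := (I.2 - I.1) / 3 in
  if f n < I.1 + d + d / 2 then (I.1 + d + d, I.2) else (I.1, I.1 + d).
pose J := fix J n := if n is n'.+1 then nxt n' (J n') else (0, 1).
have lt n : (J n).1 < (J n).2.
  elim: n => [|n]; first exact: ltr01.
  by rewrite /= /nxt; case: (J n) => a b /= ab; case: ifP => _ /=; lra.
have step n : (J n).1 <= (J n.+1).1 /\ (J n.+1).2 <= (J n).2.
  have := lt n; rewrite /= /nxt; case: (J n) => a b /= ab.
  by case: ifP => _ /=; lra.
have mono n k : (J n).1 <= (J (n + k)%N).1 /\ (J (n + k)%N).2 <= (J n).2.
  elim: k => [|k [IH1 IH2]]; first by rewrite addn0.
  rewrite addnS; have [s1 s2] := step (n + k)%N.
  by split; [apply: le_trans s1 | apply: le_trans IH2].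
have cross m n : (J m).1 <= (J n).2.
  have [m1 _] := mono m n; have [_ m2] := mono n m.
  by apply: le_trans m1 (le_trans (ltW (lt _)) _); rewrite addnC.
pose E := [set (J n).1 | n in [set: nat]].
have E0 : E !=set0 by exists (J 0%N).1, 0%N.
have Eub n : ubound E (J n).2 by move=> _ [m _ <-]; apply: cross.
exists (sup E) => n.
have lb : (J n.+1).1 <= sup E.
  by apply: sup_upper_bound; [split=> //; exists (J 0%N).2 | exists n.+1].
have ub : sup E <= (J n.+1).2 by apply: ge_sup.
have := lt n; move: lb ub; rewrite /= /nxt; case: (J n) => a b /=.
by case: ltP => /= fn lb ub ab; apply/eqP => e; lra.
Qed.

(** The fibers of k cover the uncountable line, so one of them is infinite. *)
Lemma real_infinite_fiber (k : R -> nat) : exists a, forall b,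
  exists s : seq R, [/\ uniq s, size s = b & forall x, x \in s -> k x = a].
Proof.
have [a ka] : exists a, infinite_set [set x | k x = a].
  apply: contrapT => /forallNP fin.
  have : countable [set: R].
    have -> : [set: R] = \bigcup_(a in [set: nat]) [set x | k x = a].
      by apply/seteqP; split=> // x _; exists (k x).
    apply: bigcup_countable => // a _; apply: finite_set_countable.
    by apply: contrapT; apply: fin.
  case/countable_injP => h hinj.
  pose f n := xget 0 [set x | h x = n].
  have [x fx] := real_not_enumerable f.
  have /= hx := @xgetPex _ 0 [set y | h y = h x] (ex_intro _ x erefl).
  by have /eqP := fx (h x); apply; apply: hinj; rewrite ?inE.
exists a => b; have [B Bk Bb] := infinite_set_fset b ka.
exists (take b (finmap.enum_fset B)); split.
- by rewrite take_uniq // finmap.fset_uniq.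
- by rewrite size_takel.
- by move=> x /mem_take; apply: Bk.
Qed.

End Uncountable.

(** * Ideals of polynomials *)

Lemma dependent_rows (F : fieldType) (I J : finType) (a : I -> J -> F) :
  (#|J| < #|I|)%N ->
  exists l : I -> F, (exists i, l i != 0) /\ forall j, \sum_i l i * a i j = 0.
Proof.
move=> JI; pose A : 'M[F]_(#|I|, #|J|) := \matrix_(i, j) a (enum_val i) (enum_val j).
have : kermx A != 0.
  rewrite -mxrank_eq0 mxrank_ker -lt0n subn_gt0.
  exact: leq_ltn_trans (rank_leq_col _) JI.
case/rowV0Pn => l /sub_kermxP lA l0; exists (fun i => l ord0 (enum_rank i)); split.
  apply: contrapT => /forallNP h; case/eqP: l0; apply/rowP => i.
  rewrite mxE; apply/eqP; apply: contrapT => /negP li; apply: (h (enum_val i)).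
  by rewrite enum_valK.
move=> j; have /matrixP /(_ ord0 (enum_rank j)) := lA; rewrite !mxE => e.
apply: etrans e; rewrite (reindex (@enum_val I predT)) /=; last first.
  by apply: onW_bij; apply: enum_val_bij.
by apply: eq_bigr => i _; rewrite !mxE enum_valK enum_rankK.
Qed.

Section Ideals.
Variables (R : realType) (N : nat).
Local Notation C := R[i].
Implicit Types (J : set (form R N)) (p q : form R N).

Lemma ideal0 J : is_ideal J -> J 0. Proof. by case. Qed.

Lemma idealD J p q : is_ideal J -> J p -> J q -> J (p + q).
Proof. by case=> _ + _; apply. Qed.

Lemma idealMl J p q : is_ideal J -> J q -> J (p * q).
Proof. by case=> _ _; apply. Qed.

Lemma idealMr J p q : is_ideal J -> J p -> J (p * q).
Proof. by rewrite mulrC; apply: idealMl. Qed.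

Lemma idealZ J c p : is_ideal J -> J p -> J (c *: p).
Proof. by rewrite -mul_mpolyC; apply: idealMl. Qed.

Lemma idealN J p : is_ideal J -> J p -> J (- p).
Proof. by rewrite -scaleN1r; apply: idealZ. Qed.

Lemma idealB J p q : is_ideal J -> J p -> J q -> J (p - q).
Proof. by move=> hJ Jp Jq; apply: idealD => //; apply: idealN. Qed.

Lemma ideal_sum J (I : Type) (r : seq I) (P : pred I) (F : I -> form R N) :
  is_ideal J -> (forall i, P i -> J (F i)) -> J (\sum_(i <- r | P i) F i).
Proof.
move=> hJ JF; elim/big_ind: _ => //; first exact: ideal0.
by move=> p q; apply: idealD.
Qed.

Lemma ideal_congM J p q p' q' :
  is_ideal J -> J (p - p') -> J (q - q') -> J (p * q - p' * q').
Proof.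
move=> hJ Jp Jq; have -> : p * q - p' * q' = (p - p') * q + p' * (q - q') by ring.
by apply: idealD => //; [apply: idealMr | apply: idealMl].
Qed.

Lemma ideal_congX J p p' n : is_ideal J -> J (p - p') -> J (p ^+ n - p' ^+ n).
Proof. by move=> hJ Jp; rewrite subrXX; apply: idealMr. Qed.

(** Congruences are compatible with sums and products, so the congruences
    X_i = c_i can be substituted in p. *)
Lemma ideal_cong_eval J (c : hcoord R N) p : is_ideal J ->
  (forall i, J ('X_i - (c ord0 i)%:MP)) -> J (p - (peval p c)%:MP).
Proof.
move=> hJ Jc; elim/mpolyind: p => [|a m p _ _ Jp].
  by rewrite /peval meval0 mpolyC0 subr0; apply: ideal0.
rewrite /peval mevalD mevalZ mevalX mpolyCD mpolyCM opprD addrACA.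
apply: idealD => //; rewrite -mul_mpolyC -mulrBr; apply: idealMl => //.
rewrite mpolyXE_id rmorph_prod /=.
elim/big_ind2: _ => [|x x' y y'|i _]; first by rewrite subrr; apply: ideal0.
  exact: ideal_congM.
by rewrite rmorphXn; apply: ideal_congX.
Qed.

End Ideals.

(** * The Nullstellensatz *)

Section Nullstellensatz.
Variables (R : realType) (N : nat).
Local Notation C := R[i].
Implicit Types (J : set (form R N)) (p q g : form R N).

Lemma mpoly_dependent (d k : nat) (u : 'I_k -> form R N) :
  (forall i, (msize (u i) <= d)%N) -> (#|{: 'X_{1..N.+1 < d}}| < k)%N ->
  exists a : 'I_k -> C, (exists i, a i != 0) /\ \sum_i a i *: u i = 0.
Proof.
move=> ud dk; have [|a [a0 dep]] := @dependent_rows C 'I_k 'X_{1..N.+1 < d}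
  (fun i m => (u i)@_m); first by rewrite card_ord.
exists a; split=> //; apply/mpolyP => m; rewrite mcoeff0 raddf_sum /=.
have [md|md] := ltnP (mdeg m) d.
  by rewrite -[RHS](dep (BMultinom md)); apply: eq_bigr => i _; rewrite mcoeffZ.
rewrite big1 // => i _; rewrite mcoeffZ memN_msupp_eq0 ?mulr0 //.
by apply: msize_mdeg_ge; apply: leq_trans (ud i) md.
Qed.

Definition avoids (g : form R N) (J : set (form R N)) : Prop :=
  is_ideal J /\ forall s, ~ J (g ^+ s).

(** Zorn's lemma is applied to the sets whose union with J is an ideal avoiding
    the powers of g, because the empty chain must have an upper bound as well. *)
Lemma maximal_avoiding g J : avoids g J ->
  exists P : set (form R N), [/\ J `<=` P, avoids g P &
    forall Q, avoids g Q -> P `<=` Q -> Q `<=` P].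
Proof.
move=> [hJ Jg].
have [F Fc Ftot|A [[hA Ag] Amax]] :=
    @Zorn_bigcup _ [set A | avoids g (A `|` J)].
  have up A : F A -> A `|` J `<=` (\bigcup_(X in F) X) `|` J.
    by move=> FA p [Ap|Jp]; [left; exists A | right].
  split.
    split; first by right; apply: ideal0.
      move=> p q [[A FA Ap]|Jp] [[B FB Bq]|Jq]; last by right; apply: idealD.
      + have [AB|BA] := Ftot _ _ FA FB.
          by apply: (up B) => //; apply: (idealD (Fc _ FB).1); left=> //; apply: AB.
        by apply: (up A) => //; apply: (idealD (Fc _ FA).1); left=> //; apply: BA.
      + by apply: (up A) => //; apply: (idealD (Fc _ FA).1); [left|right].
      + by apply: (up B) => //; apply: (idealD (Fc _ FB).1); [right|left].
    move=> p q [[A FA Aq]|Jq]; last by right; apply: idealMl.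
    by apply: (up A) => //; apply: (idealMl _ (Fc _ FA).1); left.
  move=> s [[A FA As]|]; last exact: Jg.
  by apply: (proj2 (Fc _ FA) s); left.
exists (A `|` J); split => [p Jp|//|Q hQ AQ]; first by right.
apply: contrapT => nQ; apply: (Amax Q); last first.
  rewrite /= (_ : Q `|` J = Q) //; apply/seteqP; split; last by move=> ?; left.
  by move=> p [//|Jp]; apply: AQ; right.
split; first by move=> p Ap; apply: AQ; left.
by move=> QA; apply: nQ => p Qp; left; apply: QA.
Qed.

Section Maximal.
Variables (g : form R N) (P : set (form R N)).
Hypothesis Pavoids : avoids g P.
Hypothesis Pmax : forall Q, avoids g Q -> P `<=` Q -> Q `<=` P.

Let hP : is_ideal P := proj1 Pavoids.

Lemma avoiding_notin t : ~ P t -> exists s u, P (g ^+ s - t * u).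
Proof.
move=> Pt; apply: contrapT => no.
apply: Pt; apply: (Pmax (Q := [set q | exists u, P (q - t * u)])).
- split=> [|s [u Pu]]; last by apply: no; exists s, u.
  split; first by exists 0; rewrite mulr0 subrr; apply: ideal0.
    move=> p q [u Pu] [v Pv]; exists (u + v).
    by rewrite mulrDr opprD addrACA; apply: idealD.
  by move=> p q [u Pu]; exists (p * u); rewrite mulrCA -mulrBr; apply: idealMl.
- by move=> q Pq; exists 0; rewrite mulr0 subr0.
- by exists 1; rewrite mulr1 subrr; apply: ideal0.
Qed.

Lemma avoiding_prime a b : P (a * b) -> P a \/ P b.
Proof.
move=> Pab; have [?|/avoiding_notin[s [u Pu]]] := pselect (P a); first by left.
have [?|/avoiding_notin[s' [u' Pu']]] := pselect (P b); first by right.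
case: (proj2 Pavoids (s + s')%N); rewrite exprD.
have := ideal_congM hP Pu Pu'.
rewrite (_ : a * u * (b * u') = (u * u') * (a * b)); last by ring.
by move=> /(idealD hP) /(_ (idealMl (u * u') hP Pab)); rewrite subrK.
Qed.

Lemma avoiding_prod (I : Type) (r : seq I) (F : I -> form R N) :
  P (\prod_(i <- r) F i) -> exists i, P (F i).
Proof.
elim: r => [|i r IH]; last first.
  by rewrite big_cons => /avoiding_prime[?|/IH//]; exists i.
rewrite big_nil => P1; case: (proj2 Pavoids 0%N).
by rewrite expr0.
Qed.

(** Otherwise each t - c divides a power of g modulo P, with quotient u_c.  As
    the field is uncountable and the polynomials have countable dimension, the
    u_c are linearly dependent for finitely many c and a fixed power of g;
    clearing denominators makes t algebraic modulo P. *)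
Lemma avoiding_residue t : exists c : C, P (t - c%:MP).
Proof.
apply: contrapT => /forallNP Pt.
have /choice[su Psu] c : exists su : nat * form R N,
    P (g ^+ su.1 - (t - c%:MP) * su.2).
  by have [s [u]] := avoiding_notin (Pt c); exists (s, u).
pose key (x : R) := pickle ((su x%:C).1, msize (su x%:C).2).
have [a fib] := real_infinite_fiber key.
have [s [d sd]] : exists s d, forall x, key x = a ->
    (su x%:C).1 = s /\ msize (su x%:C).2 = d.
  case E : (@unpickle (nat * nat)%type a) => [[s d]|].
    by exists s, d => x kx; move: E; rewrite -kx /key pickleK => -[-> ->].
  by exists 0%N, 0%N => x kx; move: E; rewrite -kx /key pickleK.
have [xs [xu xk xa]] := fib #|{: 'X_{1..N.+1 < d}}|.+1.
pose c (i : 'I_(size xs)) : C := (nth 0 xs i)%:C.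
have cP (i : 'I_(size xs)) : (su (c i)).1 = s /\ msize (su (c i)).2 = d.
  by apply/sd/xa/mem_nth.
have c_inj i j : c i = c j -> i = j.
  by case=> /eqP; rewrite nth_uniq // => /eqP /val_inj.
have [||l [[i0 l0] dep]] := @mpoly_dependent d (size xs) (fun i => (su (c i)).2).
- by move=> i; rewrite (cP i).2.
- by rewrite xk.
pose q : {poly C} := \sum_i l i *: \prod_(j | j != i) ('X - (c j)%:P).
pose ev (p : {poly C}) : form R N := (map_poly (@mpolyC N.+1 C) p).[t].
have evX z : ev ('X - z%:P) = t - z%:MP.
  by rewrite /ev rmorphB /= map_polyX map_polyC hornerXsubC.
have q0 : q != 0.
  apply: contraNneq l0 => qe0; have : q.[c i0] = 0 by rewrite qe0 horner0.
  rewrite /q horner_sum (bigD1 i0) //= [X in _ + X]big1 => [|k ki]; last first.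
    rewrite hornerZ horner_prod (bigD1 i0) //=; last by rewrite eq_sym.
    by rewrite hornerXsubC subrr mul0r mulr0.
  rewrite addr0 hornerZ horner_prod => /eqP; rewrite mulf_eq0 => /orP[//|].
  case/prodf_eq0 => j ji; rewrite hornerXsubC subr_eq0 => /eqP/c_inj ij.
  by rewrite ij eqxx in ji.
have Pq : P (g ^+ s * ev q).
  have -> : g ^+ s * ev q =
      \sum_i l i *: ((g ^+ s - (t - (c i)%:MP) * (su (c i)).2)
                          * \prod_(j | j != i) (t - (c j)%:MP)).
    rewrite (eq_bigr (fun i => g ^+ s * (l i *:
        \prod_(j | j != i) (t - (c j)%:MP))
        - \prod_j (t - (c j)%:MP) * (l i *: (su (c i)).2))); last first.
      move=> i _; rewrite [\prod_j _](bigD1 i) //= -!scalerAr -scalerBr.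
      by congr (_ *: _); ring.
    rewrite sumrB -!mulr_sumr dep mulr0 subr0; congr (_ * _).
    rewrite /ev /q rmorph_sum horner_sum; apply: eq_bigr => i _ /=.
    rewrite map_polyZ hornerZ rmorph_prod horner_prod -mul_mpolyC.
    by congr (_ * _); apply: eq_bigr => j _; rewrite -evX.
  apply: ideal_sum => // i _; apply: idealZ => //; apply: idealMr => //.
  by have := Psu (c i); rewrite (cP i).1.
have [Pgs|Pev] := avoiding_prime Pq; first by case: (proj2 Pavoids s).
have [r qr] := closed_field_poly_normal q.
move: Pev; rewrite qr /ev map_polyZ hornerZ rmorph_prod horner_prod.
rewrite (eq_bigr (fun z => t - z%:MP)) => [|z _]; last exact: evX.
case/avoiding_prime => [Pl|/avoiding_prod[z]]; last exact: Pt.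
apply: (proj2 Pavoids 0%N); have := idealZ (lead_coef q)^-1 hP Pl.
by rewrite -mul_mpolyC -mpolyCM mulVf ?lead_coef_eq0.
Qed.

End Maximal.

(** Hilbert's Nullstellensatz.  The coordinates of the point c are the residues of
    the variables modulo a maximal ideal avoiding the powers of g. *)
Lemma nullstellensatz g J : is_ideal J -> (forall s, ~ J (g ^+ s)) ->
  exists c : hcoord R N, (forall p, J p -> peval p c = 0) /\ peval g c != 0.
Proof.
move=> hJ Jg; have [P [JP Pav Pmax]] := maximal_avoiding (conj hJ Jg).
have /choice[c Pc] i := avoiding_residue Pav Pmax ('X_i : form R N).
have hP := proj1 Pav; pose x : hcoord R N := \row_i c i.
have Px p : P (p - (peval p x)%:MP).
  by apply: ideal_cong_eval => // i; rewrite mxE.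
have P0 p : P p -> peval p x = 0.
  move=> Pp; apply: contrapT => /eqP nz; case: (proj2 Pav 0%N).
  have := idealB hP Pp (Px p); rewrite opprB addrC subrK.
  by move=> /(idealZ (peval p x)^-1 hP); rewrite -mul_mpolyC -mpolyCM mulVf.
exists x; split=> [p /JP/P0//|]; apply/eqP => gx.
by case: (proj2 Pav 1%N); have := Px g; rewrite gx mpolyC0 subr0 expr1.
Qed.

End Nullstellensatz.

(** * Graded pieces *)

Section GradedPart.
Variables (n : nat) (K : comNzRingType).
Implicit Types (p q : {mpoly K[n]}) (P Q : pred 'X_{1..n}).

(** The part of p spanned by the monomials in P; for the monomials of degree d
    this is, by definition, the homogeneous component of degree d. *)
Definition mpart P p : {mpoly K[n]} :=
  \sum_(m <- msupp p | P m) p@_m *: 'X_[m].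

Lemma mcoeff_mpart P p m : (mpart P p)@_m = if P m then p@_m else 0.
Proof.
rewrite raddf_sum /=.
have [pm|pm] := boolP (m \in msupp p); last first.
  rewrite (memN_msupp_eq0 pm) if_same big_seq_cond big1 // => m' /andP[pm' _].
  rewrite mcoeffZ mcoeffX; case: eqP => [e|]; last by rewrite mulr0.
  by rewrite -e pm' in pm.
rewrite big_mkcond (bigD1_seq m) //= [X in _ + X]big1 => [|m' /negPf m'm].
  by rewrite addr0; case: (P m); rewrite ?mcoeff0 // mcoeffZ mcoeffX eqxx mulr1.
by case: (P m'); rewrite ?mcoeff0 // mcoeffZ mcoeffX m'm mulr0.
Qed.

Lemma mpartD P p q : mpart P (p + q) = mpart P p + mpart P q.
Proof.
apply/mpolyP => m; rewrite mcoeffD !mcoeff_mpart mcoeffD.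
by case: (P m); rewrite ?addr0.
Qed.

Lemma mpartZ P c p : mpart P (c *: p) = c *: mpart P p.
Proof.
apply/mpolyP => m; rewrite mcoeffZ !mcoeff_mpart mcoeffZ.
by case: (P m); rewrite ?mulr0.
Qed.

Lemma mpart0 P : mpart P 0 = 0.
Proof. by rewrite /mpart msupp0 big_nil. Qed.

Lemma mpart_sum P (I : Type) (r : seq I) (F : I -> {mpoly K[n]}) :
  mpart P (\sum_(i <- r) F i) = \sum_(i <- r) mpart P (F i).
Proof. by apply: (big_morph (mpart P)); [apply: mpartD | apply: mpart0]. Qed.

Lemma mpartX P m : mpart P 'X_[m] = if P m then 'X_[m] else 0.
Proof.
apply/mpolyP => m'; rewrite mcoeff_mpart (fun_if (mcoeff m')) mcoeff0 mcoeffX.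
by case: eqP => [->//|_]; rewrite !if_same.
Qed.

Lemma mpart_id P p : (forall m, m \in msupp p -> P m) -> mpart P p = p.
Proof.
move=> Pp; apply/mpolyP => m; rewrite mcoeff_mpart.
by case: ifPn => // /(contra (Pp m)) /memN_msupp_eq0.
Qed.

Lemma mpartP P p m : m \in msupp (mpart P p) -> P m.
Proof. by rewrite mcoeff_msupp mcoeff_mpart; case: (P m); rewrite ?eqxx. Qed.

Lemma mpartM P Q p q :
    (forall m m', m \in msupp p -> P (m + m')%MM = Q m') ->
  mpart P (p * q) = p * mpart Q q.
Proof.
move=> PQ; rewrite [p in LHS]mpolyE [p in RHS]mpolyE !mulr_suml mpart_sum.
rewrite [LHS]big_seq [RHS]big_seq; apply: eq_bigr => m pm.
elim/mpolyind: q => [|c m' q _ _ IH]; first by rewrite !(mulr0, mpart0).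
rewrite mpartD !mulrDr mpartD IH mpartZ; congr (_ + _).
rewrite -scalerAl -!scalerAr scalerA mpartZ -mpolyXD !mpartX PQ //.
by case: (Q m'); rewrite ?mulr0 ?scaler0 // -scalerAl scalerA -mpolyXD mulrC.
Qed.

End GradedPart.

(** * A determinantal locus *)

Lemma leq_pow2r (d a b : nat) : (a <= b -> a ^ d <= b ^ d)%N.
Proof. by case: d => // d; rewrite leq_exp2r. Qed.

Lemma card_mdeg (k t : nat) :
  (#|{: {m : 'X_{1..k.+1 < t.+1} | mdeg m == t}}| <= t.+1 ^ k)%N.
Proof.
pose f (m : {m : 'X_{1..k.+1 < t.+1} | mdeg m == t}) :=
  [ffun i : 'I_k => inord (bmnm (val m) (widen_ord (leqnSn k) i)) : 'I_t.+1].
have le_t (m : {m : 'X_{1..k.+1 < t.+1} | mdeg m == t}) i : (bmnm (val m) i < t.+1)%N.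
  by rewrite ltnS -[leqRHS](eqP (valP m)) mdegE (bigD1 i) //= leq_addr.
rewrite -[t.+1 in leqRHS]card_ord -[k in leqRHS]card_ord -card_ffun.
apply: (@leq_card _ _ f) => m m' /ffunP eqf; apply/val_inj/val_inj/mnmP.
have eqw i : bmnm (val m) (widen_ord (leqnSn k) i) = bmnm (val m') (widen_ord (leqnSn k) i).
  by have := congr1 (@nat_of_ord _) (eqf i); rewrite !ffunE !inordK.
have := eqP (valP m'); rewrite -[RHS](eqP (valP m)) !mdegE !big_ord_recr /=.
under eq_bigr => i _ do rewrite -eqw.
move/addnI => eql i; have [ik|ki] := ltnP i k.
  by have := eqw (Ordinal ik); congr (_ = _); congr (bmnm _ _); apply: val_inj.
by have -> : i = ord_max; first by apply: val_inj => /=; have := ltn_ord i; lia.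
Qed.

Definition snoc_fun b (x : 'I_b -> nat) (z : nat) (i : 'I_b.+1) : nat :=
  oapp x z (unlift ord_max i).

Lemma snoc_fun_lift b x z (i : 'I_b) : snoc_fun x z (lift ord_max i) = x i.
Proof. by rewrite /snoc_fun liftK. Qed.

Lemma sum_snoc_fun b x z : (\sum_i snoc_fun (b := b) x z i = \sum_i x i + z)%N.
Proof.
rewrite big_ord_recr /= /snoc_fun unlift_none; congr (_ + _)%N.
apply: eq_bigr => i _; have -> : widen_ord (leqnSn b) i = lift ord_max i.
  by apply: ord_inj; rewrite lift_max.
by rewrite liftK.
Qed.

Section Determinantal.
Variables (R : realType) (n' r' k : nat).
Local Notation C := R[i].
Local Notation n := n'.+1.
Local Notation r := r'.+1.
Variables (e : 'I_r -> nat) (M : 'I_r -> 'I_k -> form R n').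
Hypothesis e_gt0 : forall i, (0 < e i)%N.
Hypothesis M_homog : forall i j, M i j \is (e i).-homog.

(* The ring in the variables v_1..v_n, y_1..y_r. *)
Local Notation A := (form R (n' + r)).
Local Notation mon := 'X_{1..(n' + r).+1}.
Local Notation vi := (fun i : 'I_n => lshift r i : 'I_(n' + r).+1).
Local Notation yi := (fun i : 'I_r => rshift n i : 'I_(n' + r).+1).

Definition vmon (m : 'X_{1..n}) : mon :=
  [multinom if fintype.split (i : 'I_(n + r)) is inl j then m j else 0%N
    | i < (n' + r).+1].

Lemma vmon_v m i : vmon m (vi i) = m i.
Proof. by rewrite mnmE (unsplitK (inl i)). Qed.

Lemma vmon_y m i : vmon m (yi i) = 0%N.
Proof. by rewrite mnmE (unsplitK (inr i)). Qed.

Definition vlift (p : form R n') : A := \sum_(m <- msupp p) p@_m *: 'X_[vmon m].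

Lemma peval_vlift p (c : hcoord R (n' + r)) :
  peval (vlift p) c = peval p (\row_i c ord0 (vi i)).
Proof.
rewrite /peval /vlift raddf_sum [p in RHS]mpolyE raddf_sum /=.
apply: eq_bigr => m _; rewrite !mevalZ !mevalX; congr (_ * _).
rewrite (@big_split_ord _ _ _ n r) /= [X in _ * X]big1 => [|i _].
  by rewrite mulr1; apply: eq_bigr => i _; rewrite vmon_v mxE.
by rewrite vmon_y expr0.
Qed.

(** The bigrading in which all the phi_j have the same degree and the weight of
    y_i compensates the degree of row i. *)
Definition ydeg (m : mon) : nat := \sum_i m (yi i).
Definition vdeg (m : mon) : nat := \sum_i m (vi i).
Definition ywgt (m : mon) : nat := \sum_i e i * m (yi i).
Definition balanced (j : nat) : pred mon :=
  fun m => (ydeg m == j) && (vdeg m == ywgt m).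

Lemma ydegD m m' : ydeg (m + m')%MM = (ydeg m + ydeg m')%N.
Proof. by rewrite -big_split; apply: eq_bigr => i _; rewrite mnmDE. Qed.

Lemma vdegD m m' : vdeg (m + m')%MM = (vdeg m + vdeg m')%N.
Proof. by rewrite -big_split; apply: eq_bigr => i _; rewrite mnmDE. Qed.

Lemma ywgtD m m' : ywgt (m + m')%MM = (ywgt m + ywgt m')%N.
Proof. by rewrite -big_split; apply: eq_bigr => i _; rewrite mnmDE mulnDr. Qed.

Lemma balancedD j m m' :
  balanced 1 m -> balanced j.+1 (m + m')%MM = balanced j m'.
Proof.
rewrite /balanced ydegD vdegD ywgtD => /andP[/eqP -> /eqP ->].
by rewrite add1n eqSS eqn_add2l.
Qed.

Lemma mdeg_balanced m : mdeg m = (vdeg m + ydeg m)%N.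
Proof. by rewrite mdegE (@big_split_ord _ _ _ n r). Qed.

Lemma ywgt_le j m : ydeg m = j -> (ywgt m <= (\sum_i e i) * j)%N.
Proof.
move=> <-; rewrite big_distrl /=; apply: leq_sum => i _.
by rewrite leq_mul2l /ydeg (bigD1 i) //= leq_addr orbT.
Qed.

Lemma ydeg_le m : (ydeg m <= ywgt m)%N.
Proof. by apply: leq_sum => i _; rewrite leq_pmull. Qed.

Definition phi (j : 'I_k) : A := \sum_i 'X_(yi i) * vlift (M i j).

Lemma phi_balanced j m : m \in msupp (phi j) -> balanced 1 m.
Proof.
rewrite mcoeff_msupp; apply: contraR => bm; apply/eqP.
rewrite raddf_sum big1 //= => i _.
rewrite mulr_sumr raddf_sum big_seq big1 //= => m' Mm'.
rewrite -scalerAr mcoeffZ -mpolyXD mcoeffX; case: eqP => [em|]; last by rewrite mulr0.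
case/negP: bm; rewrite -em /balanced ydegD vdegD ywgtD.
have -> : ydeg (vmon m') = 0%N by rewrite /ydeg big1 // => l _; rewrite vmon_y.
have -> : ywgt (vmon m') = 0%N.
  by rewrite /ywgt big1 // => l _; rewrite vmon_y muln0.
have -> : vdeg (vmon m') = e i.
  have /= <- := dhomog_mf (M_homog i j) Mm'; rewrite mdegE.
  by apply: eq_bigr => l _; rewrite vmon_v.
have Uy l : (U_(yi i) : mon)%MM (yi l) = (i == l).
  by rewrite mnm1E (inj_eq (@rshift_inj n r)).
have -> : ydeg U_(yi i) = 1%N.
  rewrite /ydeg (bigD1 i) //= Uy eqxx big1 // => l li.
  by rewrite Uy eq_sym (negPf li).
have -> : ywgt U_(yi i) = e i.
  rewrite /ywgt (bigD1 i) //= Uy eqxx muln1 big1 ?addn0 // => l li.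
  by rewrite Uy eq_sym (negPf li) muln0.
have -> : vdeg U_(yi i) = 0%N.
  by rewrite /vdeg big1 // => l _; rewrite mnm1E (eq_rlshift i l).
by rewrite !addn0 add0n !eqxx.
Qed.

Lemma peval_phi j (c : hcoord R (n' + r)) :
  peval (phi j) c =
    \sum_i c ord0 (yi i) * peval (M i j) (\row_i c ord0 (vi i)).
Proof.
rewrite /phi /peval raddf_sum; apply: eq_bigr => i _ /=.
by rewrite mevalM mevalXU -!/(peval _ _) peval_vlift.
Qed.

Definition phi_ideal : set A :=
  [set p | exists g : 'I_k -> A, p = \sum_j phi j * g j].

Lemma phi_idealP : is_ideal phi_ideal.
Proof.
split; first by exists (fun=> 0); rewrite big1 // => j _; rewrite mulr0.
  move=> _ _ [g ->] [h ->]; exists (fun j => g j + h j).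
  by rewrite -big_split; apply: eq_bigr => j _; rewrite mulrDr.
move=> p _ [g ->]; exists (fun j => p * g j).
by rewrite mulr_sumr; apply: eq_bigr => j _; rewrite mulrCA.
Qed.

Definition drops_rank : Prop := exists (v : hcoord R n') (y : 'rV[C]_r),
  [/\ v != 0, y != 0 & forall j, \sum_i y ord0 i * peval (M i j) v = 0].

Section FullRank.
Hypothesis full : ~ drops_rank.

(** Full rank means that y = 0 or v = 0 at every common zero of the phi_j. *)
Lemma full_rank_nullstellensatz :
  exists s, forall i l, phi_ideal (('X_(vi i) * 'X_(yi l)) ^+ s).
Proof.
have /choice[f fP] (il : 'I_n * 'I_r) :
    exists s, phi_ideal (('X_(vi il.1) * 'X_(yi il.2)) ^+ s).
  apply: contrapT => /forallNP no.
  have [c [c0]] := nullstellensatz phi_idealP no.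
  rewrite /peval mevalM !mevalXU mulf_eq0 negb_or => /andP[cv cy].
  apply: full; exists (\row_i c ord0 (vi i)), (\row_i c ord0 (yi i)); split.
  - by apply: contraNneq cv => /rowP/(_ il.1); rewrite !mxE => ->.
  - by apply: contraNneq cy => /rowP/(_ il.2); rewrite !mxE => ->.
  move=> j; rewrite -[RHS](c0 (phi j)).
    by rewrite peval_phi; apply: eq_bigr => i _; rewrite mxE.
  exists (fun j' => (j' == j)%:R); rewrite (bigD1 j) //= eqxx mulr1 big1 ?addr0 //.
  by move=> l /negPf->; rewrite mulr0.
exists (\max_il f il)%N => i l.
have /subnK <- : (f (i, l) <= \max_il f il)%N by apply: leq_bigmax.
by rewrite exprD; apply: idealMl; [apply: phi_idealP | apply: (fP (i, l))].
Qed.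

(** A balanced monomial of large y-degree also has a large v-degree, hence a large
    exponent both at some v_i and at some y_l; it is divisible by a power of
    v_i y_l that lies in the ideal.  The coefficients can be taken balanced since
    the phi_i are. *)
Lemma full_rank_descent : exists j0, forall j (q : A), (j0 <= j)%N ->
    (forall m, m \in msupp q -> balanced j.+1 m) ->
  exists2 g : 'I_k -> A, q = \sum_i phi i * g i &
    forall i m, m \in msupp (g i) -> balanced j m.
Proof.
have [s sP] := full_rank_nullstellensatz.
have big_exponent b (t : nat) (F : 'I_b.+1 -> nat) :
    (b.+1 * t <= \sum_i F i)%N -> exists i, (t <= F i)%N.
  move=> bt; apply: contrapT => /forallNP no.
  have : (\sum_i F i <= \sum_(i < b.+1) t.-1)%N.
    by apply: leq_sum => i _; have /negP := no i; rewrite -ltnNge; case: (t).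
  rewrite sum_nat_const card_ord; case: t bt no => [|t] bt no.
    by case: (no ord0).
  by rewrite leqNgt (leq_trans _ bt) // ltn_mul2l ltnSn.
exists (n * s + r * s)%N => j q jb qb.
have : phi_ideal q.
  rewrite [q]mpolyE big_seq; apply: ideal_sum; first exact: phi_idealP.
  move=> m /qb /andP[/eqP ym /eqP vm].
  apply: idealZ; first exact: phi_idealP.
  have [l ml] : exists l, (s <= m (yi l))%N.
    by apply: big_exponent; rewrite -/(ydeg m) ym; lia.
  have [i mi] : exists i, (s <= m (vi i))%N.
    apply: big_exponent; rewrite -/(vdeg m) vm.
    by apply: leq_trans (ydeg_le m); rewrite ym; lia.
  have le_m : ((U_(vi i) + U_(yi l)) *+ s <= m)%MM.
    apply/mnm_lepP => x; rewrite mulmnE mnmDE !mnm1E.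
    have [<-|_] := eqVneq (vi i) x; first by rewrite (eq_rlshift l i) addn0 mul1n.
    by have [<-|_] := eqVneq (yi l) x; rewrite ?mul1n ?mul0n.
  rewrite -(submK le_m) mpolyXD -mpolyXn mpolyXD.
  by apply: idealMl; [apply: phi_idealP | apply: sP].
case=> g qg; exists (fun i => mpart (balanced j) (g i)) => [|i m]; last exact: mpartP.
rewrite -[LHS](mpart_id qb) qg mpart_sum; apply: eq_bigr => i _.
by apply: mpartM => m m' /phi_balanced /balancedD.
Qed.

Local Notation subst_phi G := (G \mPo [tuple phi i | i < k]).

(** Iterating the descent down to y-degree j0: as a module over the polynomials in
    the phi_i, the balanced polynomials are generated by monomials of bounded
    degree. *)
Lemma full_rank_generation : exists (j0 B : nat), forall t (q : A),
    (forall m, m \in msupp q -> balanced (j0 + t) m) ->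
  exists2 G : 'X_{1..(n' + r).+1 < B} -> {mpoly C[k]},
    forall b, G b \is t.-homog & q = \sum_b subst_phi (G b) * 'X_[b].
Proof.
have [j0 desc] := full_rank_descent.
exists j0, ((\sum_i e i) * j0 + j0).+1; elim=> [|t IH] q qb.
  exists (fun b => (q@_b)%:MP) => [b|].
    by rewrite -alg_mpolyC; apply: rpredZ; apply: dhomog1.
  have {1}-> := @mpolywE _ _ ((\sum_i e i) * j0 + j0).+1 q.
    by apply: eq_bigr => b _; rewrite comp_mpolyC mul_mpolyC.
  rewrite msizeE; apply/bigmax_leqP_seq => m /qb; rewrite addn0 => /andP[/eqP ym /eqP vm] _.
  by rewrite ltnS mdeg_balanced vm ym leq_add2r ywgt_le.
have [|g -> gb] := desc (j0 + t)%N q (leq_addr _ _).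
  by move=> m /qb; rewrite addnS.
have /choice[G GP] i : exists G : 'X_{1..(n' + r).+1 < ((\sum_i e i) * j0 + j0).+1} -> {mpoly C[k]},
    (forall b, G b \is t.-homog) /\ g i = \sum_b subst_phi (G b) * 'X_[b].
  by have [G G1 G2] := IH _ (gb i); exists G.
exists (fun b => \sum_i 'X_i * G i b) => [b|].
  apply: rpred_sum => i _; rewrite -add1n; apply: dhomogM; last exact: (GP i).1.
  by rewrite dhomogX /= mdeg1.
under [RHS]eq_bigr => b _ do rewrite rmorph_sum mulr_suml.
rewrite exchange_big; apply: eq_bigr => i _ /=.
rewrite (GP i).2 mulr_sumr; apply: eq_bigr => b _.
by rewrite rmorphM /= comp_mpolyXU -tnth_nth tnth_mktuple mulrA.
Qed.

(** D counts the generators of that module; the other factor is the number of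
    monomials of degree t in the phi_i, a polynomial in t of degree k - 1. *)
Lemma full_rank_count : exists j0 D, forall t (I : finType) (f : I -> mon),
    injective f -> (forall i, balanced (j0 + t) (f i)) ->
  (#|I| <= D * #|{: {m : 'X_{1..k < t.+1} | mdeg m == t}}|)%N.
Proof.
have [j0 [B gen]] := full_rank_generation.
exists j0, #|{: 'X_{1..(n' + r).+1 < B}}| => t I f f_inj fb.
have /choice[G GP] i : exists G : 'X_{1..(n' + r).+1 < B} -> {mpoly C[k]},
    (forall b, G b \is t.-homog) /\ 'X_[f i] = \sum_b subst_phi (G b) * 'X_[b].
  have [|G G1 G2] := gen t 'X_[f i]; last by exists G.
  by move=> m; rewrite msuppX inE => /eqP ->.
rewrite leqNgt -card_prod; apply/negP.
pose T := {m : 'X_{1..k < t.+1} | mdeg m == t}.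
case/(@dependent_rows C I ('X_{1..(n' + r).+1 < B} * T)%type
  (fun i bm => (G i bm.1)@_(val (val bm.2)))) => l [[i0 l0] dep].
have G0 b : \sum_i l i *: G i b = 0.
  apply/mpolyP => m; rewrite raddf_sum mcoeff0 /=.
  have [mt|mt] := eqVneq (mdeg m) t; last first.
    rewrite big1 // => i _; rewrite mcoeffZ.
    by rewrite (dhomog_nemf_coeff ((GP i).1 b)) ?mulr0.
  have mt1 : (mdeg m < t.+1)%N by rewrite mt.
  have mt2 : mdeg (BMultinom mt1) == t by apply/eqP.
  rewrite -[RHS](dep (b, Sub (BMultinom mt1) mt2)).
  by apply: eq_bigr => i _; rewrite mcoeffZ.
have : \sum_i l i *: 'X_[f i] = 0 :> A.
  under eq_bigr => i _ do rewrite (GP i).2 scaler_sumr.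
  rewrite exchange_big big1 //= => b _.
  under eq_bigr => i _ do rewrite scalerAl -comp_mpolyZ.
  by rewrite -mulr_suml -rmorph_sum /= G0 comp_mpoly0 mul0r.
move/(congr1 (mcoeff (f i0))); rewrite mcoeff0 raddf_sum (bigD1 i0) //=.
rewrite mcoeffZ mcoeffX eqxx mulr1 big1 ?addr0 => [/eqP|i ii0]; first exact/negP.
by rewrite mcoeffZ mcoeffX (inj_eq f_inj) (negPf ii0) mulr0.
Qed.

(** Choosing freely all the exponents but the last one of each group gives
    q ^ (n + r - 2) balanced monomials of y-degree j when j >= (n + r - 2) q. *)
Lemma many_balanced j q : ((n' + r') * q <= j)%N ->
  exists2 f : {ffun 'I_n' -> 'I_q} * {ffun 'I_r' -> 'I_q} -> mon,
    injective f & forall x, balanced j (f x).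
Proof.
move=> qj.
pose y (x : {ffun 'I_n' -> 'I_q} * {ffun 'I_r' -> 'I_q}) : 'I_r -> nat :=
  snoc_fun (fun l => x.2 l) (j - \sum_l x.2 l).
pose v (x : {ffun 'I_n' -> 'I_q} * {ffun 'I_r' -> 'I_q}) : 'I_n -> nat :=
  snoc_fun (fun i => x.1 i) (\sum_l e l * y x l - \sum_i x.1 i).
pose f x : mon := [multinom match fintype.split (i : 'I_(n + r)) with
    inl a => v x a | inr b => y x b end | i < (n' + r).+1].
have fv x i : f x (vi i) = v x i by rewrite mnmE (unsplitK (inl i)).
have fy x i : f x (yi i) = y x i by rewrite mnmE (unsplitK (inr i)).
have le_q b (z : {ffun 'I_b -> 'I_q}) : (\sum_i z i <= b * q)%N.
  rewrite -[b in leqRHS]card_ord -sum_nat_const.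
  by apply: leq_sum => i _; apply: ltnW.
have yj x : \sum_l y x l = j.
  by rewrite sum_snoc_fun subnKC //; apply: leq_trans (le_q _ _) _; lia.
exists f => [x x' eqf|x].
  have e2 : x.2 = x'.2.
    apply/ffunP => l; apply: val_inj; have := congr1 (fun m : mon => m (yi (lift ord_max l))) eqf.
    by rewrite /= !fy /y !snoc_fun_lift.
  have e1 : x.1 = x'.1.
    apply/ffunP => l; apply: val_inj; have := congr1 (fun m : mon => m (vi (lift ord_max l))) eqf.
    by rewrite /= !fv /v !snoc_fun_lift.
  by case: x x' e1 e2 {eqf} => ? ? [? ?] /= -> ->.
have ejy : (j <= \sum_l e l * y x l)%N.
  by rewrite -(yj x); apply: leq_sum => l _; rewrite leq_pmull.
apply/andP; split; apply/eqP.
  by rewrite /ydeg -[RHS](yj x); apply: eq_bigr => i _; rewrite fy.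
rewrite /vdeg /ywgt; under eq_bigr => i _ do rewrite fv.
under [RHS]eq_bigr => i _ do rewrite fy.
rewrite sum_snoc_fun subnKC //; apply: leq_trans (le_q _ _) (leq_trans _ ejy); lia.
Qed.

End FullRank.

(** If the rank never dropped, the algebra of balanced polynomials would be finite
    over the k elements phi_j of y-degree 1, so its graded pieces would grow at most
    with degree k - 1; but they grow with degree n + r - 2.  The bound on k says
    that the expected codimension k - r + 1 of the degeneracy locus in P^(n-1) is at
    most n - 1. *)
Lemma determinantal_locus_nonempty : (k <= n' + r')%N -> drops_rank.
Proof.
move=> knr; apply: contrapT => full.
have [j0 [D cnt]] := full_rank_count full.
set w := (n' + r')%N in knr *.
have [k0|k_gt0] := posnP k.
  apply: full; exists (\row__ 1), (\row__ 1).
  have nz b : (\row__ 1 : 'rV[C]_b.+1) != 0.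
    by apply/eqP => /rowP/(_ ord0)/eqP; rewrite !mxE oner_eq0.
  by split=> // j; have := ltn_ord j; rewrite [X in (_ < X)%N]k0.
have w_gt0 : (0 < w)%N by lia.
(* For this q, the q^w balanced monomials outnumber D * ((w + 1) * q)^(k - 1). *)
pose q := (j0 + D * (w + 1) ^ k.-1 + 1)%N.
have [f f_inj fb] := @many_balanced (j0 + (w * q - j0)) q ltac:(rewrite -/w /q; nia).
have := cnt _ _ f f_inj fb.
rewrite card_prod !card_ffun !card_ord -expnD -/w; apply/negP; rewrite -ltnNge.
have := card_mdeg k.-1 (w * q - j0); rewrite prednK // => le1.
apply: leq_ltn_trans (leq_mul (leqnn D) le1) _.
have le2 : ((w * q - j0).+1 <= (w + 1) * q)%N by rewrite /q; nia.
apply: leq_ltn_trans (leq_mul (leqnn D) (leq_pow2r k.-1 le2)) _.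
rewrite expnMn mulnA.
apply: (@leq_trans (q ^ k.-1.+1)); last by rewrite leq_pexp2l // /q; lia.
by rewrite expnS ltn_mul2r expn_gt0 /q; lia.
Qed.
End Determinantal.

(** * Homogeneous coordinates and Zariski closed sets *)

Section Homogeneous.
Variables (R : realType) (N : nat).
Local Notation C := R[i].
Implicit Types (p q : form R N) (x y z : hcoord R N) (X : set (hcoord R N)).

Lemma peval_homog d p c x : p \is d.-homog -> peval p (c *: x) = c ^+ d * peval p x.
Proof.
move=> hp; rewrite /peval !mevalE mulr_sumr !big_seq; apply: eq_bigr => m pm.
rewrite mulrCA; congr (_ * _); have /= <- := dhomog_mf hp pm.
under eq_bigr => i _ do rewrite mxE exprMn.
by rewrite big_split /= prodrXr -mdegE.
Qed.

Lemma poly_eq0_nz (q : {poly C}) : (forall c, c != 0 -> q.[c] = 0) -> q = 0.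
Proof.
move=> q0; apply/eqP; apply: contraT => nz.
have := @max_poly_roots _ q [seq (i.+1)%:R | i <- iota 0 (size q)] nz.
rewrite size_map size_iota ltnn; apply.
  by apply/allP => _ /mapP[i _ ->]; apply/rootP/q0; rewrite pnatr_eq0.
by rewrite map_inj_uniq ?iota_uniq // => i j /eqP; rewrite eqr_nat => /eqP[].
Qed.

Lemma form_components p : p = \sum_(d < msize p) pihomog mdeg d p.
Proof. by apply: (@pihomog_partitionE _ _ mdeg). Qed.

(** On the line through x the component of degree d is a multiple of c^d, so the
    values of the components are the coefficients of a polynomial in c that has
    infinitely many zeros. *)
Lemma peval_components p x :
  (forall c, c != 0 -> peval p (c *: x) = 0) ->
  forall d, peval (pihomog mdeg d p) x = 0.
Proof.
move=> p0 d; have [dp|pd] := ltnP d (msize p); last first.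
  rewrite pihomogE big_seq_cond big1 ?[peval _ _]meval0 // => m /andP[pm /eqP /= md].
  by have := msize_mdeg_lt pm; rewrite md ltnNge pd.
pose q := \poly_(d < msize p) peval (pihomog mdeg d p) x.
have : q = 0.
  apply: poly_eq0_nz => c c0; rewrite horner_poly -[RHS](p0 c c0) [in RHS](form_components p).
  rewrite /peval raddf_sum; apply: eq_bigr => i _ /=.
  by rewrite -![meval _ _]/(peval _ _) (@peval_homog i) ?pihomogP // mulrC.
by move/(congr1 (fun q : {poly C} => q`_d)); rewrite coef_poly dp coef0.
Qed.

Lemma same_point_refl x : same_point x x.
Proof. by exists 1; rewrite ?oner_neq0 // scale1r. Qed.

Lemma same_point_sym x y : same_point x y -> same_point y x.
Proof. by case=> c c0 ->; exists c^-1; rewrite ?invr_neq0 // scalerA mulVf // scale1r. Qed.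

Lemma same_point_trans x y z : same_point x y -> same_point y z -> same_point x z.
Proof. by case=> c c0 -> [d d0 ->]; exists (d * c); rewrite ?mulf_neq0 // scalerA. Qed.

Lemma closed_same_point X x y : zariski_closed X -> same_point x y -> X x -> X y.
Proof.
case=> A hA -> [c c0 ->] [x0 xA]; split; first by rewrite scaler_eq0 negb_or c0.
by move=> p Ap; have [d pd] := hA p Ap; rewrite (peval_homog _ _ pd) xA // mulr0.
Qed.

Lemma vanishing_ideal_ideal X : is_ideal (vanishing_ideal X).
Proof.
split; first by move=> x _; rewrite /peval meval0.
  by move=> p q p0 q0 x Xx; rewrite /peval mevalD -!/(peval _ _) p0 ?q0 ?addr0.
by move=> p q q0 x Xx; rewrite /peval mevalM -!/(peval _ _) q0 ?mulr0.
Qed.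

Lemma vanishing_ideal_homogeneous X :
  zariski_closed X -> is_homogeneous (vanishing_ideal X).
Proof.
move=> cX p d p0 x Xx; apply: peval_components => c c0; apply: p0.
by apply: closed_same_point Xx => //; exists c.
Qed.

End Homogeneous.

(** * Invariance of the dimension *)

Section Regular.
Variables (R : realType) (M N : nat).
Implicit Types (X : set (hcoord R M)) (Z : set (hcoord R N)).
Implicit Type f : hcoord R M -> hcoord R N.

Lemma dhomog_comp d e (p : form R N) (F : 'I_N.+1 -> form R M) :
  p \is d.-homog -> (forall i, F i \is e.-homog) ->
  (p \mPo [tuple F i | i < N.+1]) \is (e * d).-homog.
Proof.
move=> hp hF; rewrite comp_mpolyE big_seq; apply: rpred_sum => m pm; apply: rpredZ.
have /= <- := dhomog_mf hp pm; rewrite mdegE big_distrr /=.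
elim/big_ind2: _ => [|x1 x2 y1 y2|i _]; first exact: dhomog1.
  exact: dhomogM.
by rewrite tnth_mktuple; apply: dhomogMn.
Qed.

Lemma peval_comp (p : form R N) (F : 'I_N.+1 -> form R M) x :
  peval (p \mPo [tuple F i | i < N.+1]) x = peval p (\row_i peval (F i) x).
Proof.
rewrite /peval comp_mpoly_meval; apply: meval_eq => i.
by rewrite tnth_mktuple mxE.
Qed.

Lemma regular_same_point X f x y : regular_map X f -> X x -> X y ->
  same_point x y -> same_point (f x) (f y).
Proof.
move=> fr Xx Xy [c c0 yE]; have [g [F [e [d [hg hF gx near]]]]] := fr x Xx.
have gy : peval g y != 0.
  by rewrite yE (peval_homog _ _ hg) mulf_neq0 // expf_neq0.
have [_ fx] := near x Xx gx; have [_ fy] := near y Xy gy.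
apply: same_point_trans (same_point_sym fx) _; apply: same_point_trans fy.
exists (c ^+ d); first by rewrite expf_neq0.
by apply/rowP => i; rewrite !mxE yE (peval_homog _ _ (hF i)).
Qed.

(** Where f is given by forms F on the open set g != 0, pulling back an equation p
    of Z and multiplying by g yields a form that vanishes on the whole preimage;
    all these forms together cut it out. *)
Lemma regular_preimage_closed X Z f : zariski_closed X -> zariski_closed Z ->
  regular_map X f -> zariski_closed [set x | X x /\ Z (f x)].
Proof.
move=> [A hA XE] cZ fr.
pose B := [set h : form R M | (exists d, h \is d.-homog) /\
                              forall x, X x -> Z (f x) -> peval h x = 0].
exists (A `|` B); first by move=> p [/hA|[]].
apply/seteqP; split=> x /=.
  move=> [Xx Zx]; split; first by move: Xx; rewrite XE => -[].
  by move=> p [Ap|[_]]; [move: Xx; rewrite XE => -[_]; apply | apply].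
move=> [x0 xAB]; have Xx : X x by rewrite XE; split=> // p Ap; apply: xAB; left.
split=> //; apply: contrapT => nZ.
have [g [F [e [d [hg hF gx near]]]]] := fr x Xx.
have [Fx0 Fx] := near x Xx gx.
have [A' hA' ZE] := cZ; have [p [A'p pFx]] :
    exists p, A' p /\ peval p (\row_i peval (F i) x) != 0.
  apply: contrapT => /forallNP no; apply: nZ.
  apply: closed_same_point Fx _ => //; rewrite ZE; split=> // p A'p.
  by apply/eqP; apply: contrapT => /negP pF; apply: (no p).
have [d' hp] := hA' p A'p.
have : peval (g * (p \mPo [tuple F i | i < N.+1])) x = 0.
  apply: xAB; right; split.
    by exists (e + d * d')%N; apply: dhomogM => //; apply: dhomog_comp.
  move=> y Xy Zy; rewrite /peval mevalM -!/(peval _ _) peval_comp.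
  have [->|gy] := eqVneq (peval g y) 0; first by rewrite mul0r.
  have [_ Fy] := near y Xy gy; have := closed_same_point cZ (same_point_sym Fy) Zy.
  by rewrite ZE => -[_ ->]; rewrite ?mulr0.
move/eqP; rewrite /peval mevalM -!/(peval _ _) peval_comp mulf_eq0.
by rewrite (negPf gx) (negPf pFx).
Qed.

End Regular.

Section Isomorphism.
Variables (R : realType) (M N : nat).
Variables (X : set (hcoord R M)) (Y : set (hcoord R N)).
Variables (f : hcoord R M -> hcoord R N) (g : hcoord R N -> hcoord R M).
Hypotheses (cX : zariski_closed X) (cY : zariski_closed Y).
Hypotheses (fr : regular_map X f) (gr : regular_map Y g).
Hypothesis fXY : forall x, X x -> Y (f x).
Hypothesis gf : forall x, X x -> same_point (g (f x)) x.
Hypothesis fg : forall y, Y y -> same_point (f (g y)) y.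

Let transport (Z : set (hcoord R M)) := [set y | Y y /\ Z (g y)].

(** The transport of Z is its image under f, written as a preimage under g so that
    it is closed by continuity of g. *)
Lemma transport_variety Z : projective_variety Z -> Z `<=` X ->
  projective_variety (transport Z).
Proof.
move=> [cZ [[x Zx] irr]] ZX; split; first exact: regular_preimage_closed.
have inZ z : Z z -> Z (g (f z)).
  by move=> Zz; apply: (closed_same_point cZ _ Zz); apply/same_point_sym/gf/ZX.
split; first by exists (f x); split; [apply/fXY/ZX | apply: inZ].
move=> A B cA cB AB.
have back D : zariski_closed D -> Z `<=` [set z | X z /\ D (f z)] ->
    transport Z `<=` D.
  by move=> cD ZD y [Yy /ZD[_]]; apply: closed_same_point => //; apply: fg.
have cA' := regular_preimage_closed cX cA fr.
have cB' := regular_preimage_closed cX cB fr.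
have ZAB : Z `<=` [set z | X z /\ A (f z)] `|` [set z | X z /\ B (f z)].
  move=> z Zz; have Xz := ZX z Zz.
  by have [|Af|Bf] := AB (f z); [split; [apply: fXY | apply: inZ] | left | right].
by have [ZA|ZB] := irr _ _ cA' cB' ZAB; [left | right]; apply: back.
Qed.

Lemma isomorphic_chain k : has_variety_chain X k -> has_variety_chain Y k.
Proof.
move=> [Z [Zv Zs]]; exists (fun i => transport (Z i)); split=> i ik.
  by have [Zi ZX] := Zv i ik; split; [apply: transport_variety | move=> y []].
have [sub nsub] := Zs i ik; split; first by move=> y [Yy /sub].
move=> sub'; apply: nsub => z Zz.
have [[cZ' _] ZX'] := Zv i.+1 ik; have [[cZ _] _] := Zv i (ltnW ik).
have Xz := ZX' z Zz; have [|_] := sub' (f z).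
  split; first exact: fXY.
  by apply: (closed_same_point cZ' _ Zz); apply/same_point_sym/gf.
by apply: closed_same_point => //; apply: gf.
Qed.

End Isomorphism.

Section Dimension.
Variable R : realType.

Lemma variety_chain_le N (X : set (hcoord R N)) k l : (l <= k)%N ->
  has_variety_chain X k -> has_variety_chain X l.
Proof.
move=> lk [Z [Zv Zs]]; exists Z; split=> i il.
  by apply: Zv; apply: leq_trans lk.
by apply: Zs; apply: leq_trans lk.
Qed.

Lemma dim_unique N M (X : set (hcoord R M)) (Y : set (hcoord R N)) n n' :
  (forall k, has_variety_chain X k <-> has_variety_chain Y k) ->
  has_dim X n -> has_dim Y n' -> n = n'.
Proof.
move=> XY [cX nX] [cY nY]; apply/eqP; rewrite eqn_leq; apply/andP; split.
  by rewrite leqNgt; apply/negP => lt; apply/nY/(variety_chain_le lt)/XY.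
by rewrite leqNgt; apply/negP => lt; apply/nX/(variety_chain_le lt)/XY.
Qed.

Lemma embedding_dim M N (X : set (hcoord R M)) (f : hcoord R M -> hcoord R N) n n' :
  zariski_closed X -> embedding X f ->
  has_dim X n -> has_dim (point_image X f) n' -> n = n'.
Proof.
move=> cX [fr cY [g gr gf]]; set Y := point_image X f in cY gr *.
have fXY x : X x -> Y (f x) by move=> Xx; exists x => //; apply: same_point_refl.
have g_pt y x : X x -> same_point (f x) y -> same_point (g y) x.
  move=> Xx xy; apply: same_point_trans (gf x Xx).
  by apply: (regular_same_point gr _ (fXY _ Xx) (same_point_sym xy)); exists x.
have gYX y : Y y -> X (g y).
  move=> [x Xx xy]; apply: (closed_same_point cX _ Xx).
  exact/same_point_sym/g_pt.
have fg y : Y y -> same_point (f (g y)) y.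
  move=> Yy; have [x Xx xy] := Yy; apply: (same_point_trans _ xy).
  by apply: (regular_same_point fr (gYX _ Yy) Xx); apply: g_pt.
apply: dim_unique => k; split.
  exact: (isomorphic_chain cX cY fr gr fXY gf fg).
exact: (isomorphic_chain cY cX gr fr gYX fg gf).
Qed.

End Dimension.

(** * Directional derivatives *)

Section Derivatives.
Variables (R : realType) (N : nat).
Local Notation C := R[i].
Implicit Types (p q : form R N) (x w a : hcoord R N).

Definition dirder w p : form R N := \sum_i w ord0 i *: p^`M(i).

Lemma peval_dirder w p x :
  peval (dirder w p) x = \sum_i peval p^`M(i) x * w ord0 i.
Proof.
by rewrite /peval raddf_sum; apply: eq_bigr => i _ /=; rewrite mevalZ mulrC.
Qed.

Lemma pevalD p q x : peval (p + q) x = peval p x + peval q x.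
Proof. exact: mevalD. Qed.
Lemma pevalB p q x : peval (p - q) x = peval p x - peval q x.
Proof. exact: mevalB. Qed.
Lemma pevalM p q x : peval (p * q) x = peval p x * peval q x.
Proof. exact: mevalM. Qed.
Lemma pevalZ c p x : peval (c *: p) x = c * peval p x.
Proof. exact: mevalZ. Qed.
Lemma pevalX p d x : peval (p ^+ d) x = peval p x ^+ d.
Proof. by rewrite /peval rmorphXn. Qed.
Lemma peval0 x : peval 0 x = 0. Proof. exact: meval0. Qed.
Lemma peval1 x : peval 1 x = 1. Proof. exact: meval1. Qed.
Lemma peval_sum (I : Type) (r : seq I) (P : pred I) (F : I -> form R N) x :
  peval (\sum_(i <- r | P i) F i) x = \sum_(i <- r | P i) peval (F i) x.
Proof. exact: raddf_sum. Qed.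

Lemma dirder_is_linear w : linear (dirder w).
Proof.
move=> c p q; rewrite /dirder scaler_sumr -big_split; apply: eq_bigr => i _ /=.
by rewrite mderivD mderivZ scalerDr !scalerA mulrC.
Qed.
HB.instance Definition _ w :=
  GRing.isLinear.Build C (form R N) (form R N) _ (dirder w) (dirder_is_linear w).

Lemma dirderD w p q : dirder w (p + q) = dirder w p + dirder w q.
Proof. exact: raddfD. Qed.
Lemma dirderB w p q : dirder w (p - q) = dirder w p - dirder w q.
Proof. exact: raddfB. Qed.
Lemma dirderZ w c p : dirder w (c *: p) = c *: dirder w p.
Proof. exact: linearZ. Qed.
Lemma dirder_sum w (J : Type) (r : seq J) (F : J -> form R N) :
  dirder w (\sum_(j <- r) F j) = \sum_(j <- r) dirder w (F j).
Proof. exact: raddf_sum. Qed.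

Lemma dirderM w p q : dirder w (p * q) = dirder w p * q + p * dirder w q.
Proof.
rewrite /dirder mulr_suml mulr_sumr -big_split; apply: eq_bigr => i _ /=.
by rewrite mderivM scalerDr scalerAl scalerAr.
Qed.

Lemma peval_dirderM w p q x : peval (dirder w (p * q)) x =
  peval (dirder w p) x * peval q x + peval p x * peval (dirder w q) x.
Proof. by rewrite dirderM pevalD !pevalM. Qed.

Lemma peval_dirderD w c p d q x : peval (dirder w (c *: p + d *: q)) x =
  c * peval (dirder w p) x + d * peval (dirder w q) x.
Proof. by rewrite dirderD !dirderZ pevalD !pevalZ. Qed.

Lemma dirder1 w : dirder w 1 = 0.
Proof. by rewrite /dirder big1 // => i _; rewrite -mpolyC1 mderivC scaler0. Qed.

Lemma dirder_component w p d :
  pihomog mdeg d (dirder w p) = dirder w (pihomog mdeg d.+1 p).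
Proof.
rewrite /dirder raddf_sum; apply: eq_bigr => i _ /=; rewrite linearZ /=; congr (_ *: _).
apply/mpolyP => m; rewrite mcoeff_deriv.
rewrite (mcoeff_mpart (fun m => mdeg m == d)) (mcoeff_mpart (fun m => mdeg m == d.+1)).
rewrite mcoeff_deriv mdegD mdeg1 addn1 eqSS.
by case: eqP => // _; rewrite mul0rn.
Qed.

Lemma dirder_component0 w p : dirder w (pihomog mdeg 0 p) = 0.
Proof.
have -> : pihomog mdeg 0 p = (p@_0)%:MP.
  apply/mpolyP => m; rewrite (mcoeff_mpart (fun m => mdeg m == 0%N)) mcoeffC mdeg_eq0 eq_sym.
  by case: eqP => [->|_]; rewrite ?mulr1 ?mulr0.
by rewrite /dirder big1 // => i _; rewrite mderivC scaler0.
Qed.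

Lemma dirder_homog w p d : p \is d.-homog -> dirder w p \is d.-1.-homog.
Proof.
move=> hp; rewrite -(pihomog_dE hp); case: d hp => [|d] hp.
  by rewrite dirder_component0 dhomog0.
by rewrite -dirder_component pihomogP.
Qed.

(** Euler's identity, checked on monomials. *)
Lemma peval_euler p d x : p \is d.-homog -> peval (dirder x p) x = d%:R * peval p x.
Proof.
move=> hp; rewrite peval_dirder [p in RHS]mpolyE peval_sum.
transitivity (\sum_i \sum_(m <- msupp p) peval ((p@_m *: 'X_[m])^`M(i)) x * x ord0 i).
  by apply: eq_bigr => i _; rewrite -mulr_suml -peval_sum -raddf_sum -mpolyE.
rewrite exchange_big mulr_sumr !big_seq; apply: eq_bigr => m pm /=.
have /= <- := dhomog_mf hp pm; rewrite mdegE natr_sum mulr_suml.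
apply: eq_bigr => i _; rewrite linearZ /= mderivX !pevalZ -mulrA [RHS]mulrCA; congr (_ * _).
rewrite -mulrA; have [m0|m_gt0] := posnP (m i); first by rewrite m0 !mul0r.
congr (_ * _); have /submK e : (U_(i) <= m)%MM by rewrite lep1mP -lt0n.
by rewrite -[in RHS]e mpolyXD pevalM [peval 'X_i _]mevalXU.
Qed.

Definition dot a w : C := \sum_i a ord0 i * w ord0 i.

Lemma dotDl a b w : dot (a + b) w = dot a w + dot b w.
Proof. by rewrite /dot -big_split; apply: eq_bigr => i _; rewrite mxE mulrDl. Qed.
Lemma dotZl c a w : dot (c *: a) w = c * dot a w.
Proof. by rewrite /dot mulr_sumr; apply: eq_bigr => i _; rewrite mxE mulrA. Qed.
Lemma dotC a w : dot a w = dot w a.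
Proof. by apply: eq_bigr => i _; rewrite mulrC. Qed.
Lemma dot0l w : dot 0 w = 0.
Proof. by rewrite /dot big1 // => i _; rewrite mxE mul0r. Qed.
Lemma dotDr a w w' : dot a (w + w') = dot a w + dot a w'.
Proof. by rewrite dotC dotDl !(dotC a). Qed.
Lemma dotZr c a w : dot a (c *: w) = c * dot a w.
Proof. by rewrite dotC dotZl dotC. Qed.
Lemma dot_suml (I : Type) (r : seq I) (F : I -> hcoord R N) w :
  dot (\sum_(i <- r) F i) w = \sum_(i <- r) dot (F i) w.
Proof. by apply: (big_morph (dot^~ w)); [move=> ? ?; apply: dotDl | apply: dot0l]. Qed.
Lemma dot_sumr (I : Type) (r : seq I) (F : I -> hcoord R N) a :
  dot a (\sum_(i <- r) F i) = \sum_(i <- r) dot a (F i).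
Proof. by rewrite dotC dot_suml; apply: eq_bigr => i _; rewrite dotC. Qed.

Definition linform a : form R N := \sum_i a ord0 i *: 'X_i.

Lemma linform_homog a : linform a \is 1.-homog.
Proof.
by apply: rpred_sum => i _; apply: rpredZ; rewrite dhomogX /= mdeg1.
Qed.

Lemma peval_linform a x : peval (linform a) x = dot a x.
Proof.
rewrite /linform peval_sum; apply: eq_bigr => i _.
by rewrite pevalZ [peval 'X_i _]mevalXU.
Qed.

Lemma dirder_linform w a : dirder w (linform a) = (dot a w)%:MP.
Proof.
rewrite /dirder /linform /dot rmorph_sum; apply: eq_bigr => i _ /=.
rewrite (raddf_sum (mderiv i)) (bigD1 i) //= mderivZ mderivX mnm1E eqxx scale1r.
rewrite [X in _ + X]big1 => [|j ji]; last first.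
  by rewrite mderivZ mderivX mnm1E (negPf ji) scale0r scaler0.
have -> : (U_(i) - U_(i) = 0 :> 'X_{1..N.+1})%MM.
  by apply/mnmP => j; rewrite mnmBE subnn mnm0E.
by rewrite addr0 scalerA mpolyX0 mulrC alg_mpolyC.
Qed.

Lemma linform_sum (I : Type) (r : seq I) (c : I -> C) (F : I -> hcoord R N) :
  linform (\sum_(i <- r) c i *: F i) = \sum_(i <- r) c i *: linform (F i).
Proof.
rewrite /linform; under [RHS]eq_bigr => i _ do rewrite scaler_sumr.
rewrite exchange_big; apply: eq_bigr => j _ /=.
rewrite summxE scaler_suml; apply: eq_bigr => i _.
by rewrite mxE scalerA.
Qed.

End Derivatives.

(** * Powers of the maximal ideal of a point *)

Section MaximalIdeal.
Variables (R : realType) (N : nat).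
Local Notation C := R[i].
Implicit Types (p q a : form R N) (x w : hcoord R N) (K : set (form R N)).
Implicit Type s : seq (form R N).

Lemma ideal_quotient K u : is_ideal K -> is_ideal [set p | K (u * p)].
Proof.
move=> hK; split=> [|p q|p q] /=; first by rewrite mulr0; apply: ideal0.
  by rewrite mulrDr; apply: idealD.
by rewrite mulrCA; apply: idealMl.
Qed.

(** The d-th power of the ideal of all polynomials vanishing at x, as the
    smallest ideal that contains the products of d of them: inclusions of powers
    are then checked on products. *)
Definition mpow x d : set (form R N) := [set p | forall K, is_ideal K ->
  (forall s, size s = d -> (forall a, a \in s -> peval a x = 0) ->
     K (\prod_(a <- s) a)) -> K p].

Lemma mpow_ideal x d : is_ideal (mpow x d).
Proof.
split=> [K hK _|p q hp hq K hK gen|p q hq K hK gen]; first exact: ideal0.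
  by apply: idealD => //; [apply: hp | apply: hq].
by apply: idealMl => //; apply: hq.
Qed.

Lemma mpow_prod x s : (forall a, a \in s -> peval a x = 0) ->
  mpow x (size s) (\prod_(a <- s) a).
Proof. by move=> s0 K hK; apply. Qed.

Lemma mpow1 x p : peval p x = 0 -> mpow x 1 p.
Proof.
move=> p0; have := @mpow_prod x [:: p]; rewrite big_seq1; apply.
by move=> a; rewrite inE => /eqP ->.
Qed.

Lemma mpow0 x p : mpow x 0 p.
Proof.
rewrite -[p]mulr1; apply: (idealMl p (mpow_ideal x 0)).
by have := @mpow_prod x [::]; rewrite big_nil; apply.
Qed.

Lemma mpowM x d e p q : mpow x d p -> mpow x e q -> mpow x (d + e) (p * q).
Proof.
move=> hp hq; rewrite mulrC; apply: (hp [set p | mpow x (d + e) (q * p)]).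
  exact/ideal_quotient/mpow_ideal.
move=> s sd s0; rewrite /= mulrC.
apply: (hq [set q | mpow x (d + e) (\prod_(a <- s) a * q)]).
  exact/ideal_quotient/mpow_ideal.
move=> s' se s'0; rewrite /= -big_cat -sd -se -size_cat; apply: mpow_prod.
by move=> a; rewrite mem_cat => /orP[/s0|/s'0].
Qed.

(** Taylor's formula: in p = sum_i (X_i - x_i) g_i the value of g_i at x is the
    i-th partial derivative of p. *)
Lemma mpow2 x p : peval p x = 0 -> (forall w, peval (dirder w p) x = 0) -> mpow x 2 p.
Proof.
move=> p0 dp0.
pose K := [set p | exists g : 'I_N.+1 -> form R N,
  p = \sum_i ('X_i - (x ord0 i)%:MP) * g i].
have hK : is_ideal K.
  split; first by exists (fun=> 0); rewrite big1 // => i _; rewrite mulr0.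
    move=> _ _ [g ->] [h ->]; exists (fun i => g i + h i).
    by rewrite -big_split; apply: eq_bigr => i _; rewrite mulrDr.
  move=> q _ [g ->]; exists (fun i => q * g i).
  by rewrite mulr_sumr; apply: eq_bigr => i _; rewrite mulrCA.
have [i|g pE] := @ideal_cong_eval _ _ K x p hK.
  exists (fun j => (j == i)%:R); rewrite (bigD1 i) //= eqxx mulr1 big1 ?addr0 //.
  by move=> j /negPf ->; rewrite mulr0.
have X0 i : peval ('X_i - (x ord0 i)%:MP) x = 0.
  by rewrite /peval mevalB mevalXU mevalC subrr.
have g0 i : peval (g i) x = 0.
  rewrite -(dp0 (delta_mx ord0 i)); move: pE; rewrite p0 mpolyC0 subr0 => ->.
  rewrite raddf_sum peval_sum (bigD1 i) //= big1 => [|j ji].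
    rewrite addr0 peval_dirderM X0 mul0r addr0.
    rewrite dirderB /dirder (bigD1 i) //= big1 => [|j ji]; last first.
      by rewrite mxE eqxx /= (negPf ji) scale0r.
    rewrite addr0 big1 => [|j _]; last by rewrite mderivC scaler0.
    rewrite mxE !eqxx scale1r subr0 mderivX mnm1E eqxx scale1r.
    have -> : (U_(i) - U_(i) = 0 :> 'X_{1..N.+1})%MM.
      by apply/mnmP => j; rewrite mnmBE subnn mnm0E.
    by rewrite mpolyX0 peval1 mul1r.
  rewrite peval_dirderM X0 mul0r addr0.
  rewrite dirderB /dirder big1 => [|l _]; last first.
    rewrite mxE eqxx /= mderivX mnm1E; case: (eqVneq l i) => [->|_].
      by rewrite (negPf ji) scale0r scaler0.
    by rewrite scale0r.
  by rewrite big1 ?subrr ?peval0 ?mul0r // => l _; rewrite mderivC scaler0.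
move: pE; rewrite p0 mpolyC0 subr0 => ->.
apply: (ideal_sum _ (mpow_ideal x 2)) => i _.
by apply: (@mpowM _ 1 1); apply: mpow1.
Qed.

End MaximalIdeal.

(** * Linear algebra of the tangent space *)

Section Subspaces.
Variables (F : fieldType).

(** A subspace of maximal dimension contained in P exhausts P. *)
Lemma subspace_vspace (V : vectType F) (P : V -> Prop) :
  P 0 -> (forall c u v, P u -> P v -> P (c *: u + v)) ->
  exists W : {vspace V}, forall u, u \in W <-> P u.
Proof.
move=> P0 PD.
suff H m : forall W : {vspace V}, (forall u, u \in W -> P u) ->
    (dim V - \dim W <= m)%N -> exists W' : {vspace V}, forall u, u \in W' <-> P u.
  apply: (H (dim V) 0%VS); last by rewrite leq_subr.
  by move=> u; rewrite memv0 => /eqP ->.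
elim: m => [|m IH] W WP dW.
  exists W => u; split; first exact: WP.
  have -> : W = fullv by apply/eqP; rewrite eqEdim subvf dimvf -subn_eq0 -leqn0.
  by rewrite memvf.
have [WE|] := pselect (forall u, P u -> u \in W).
  by exists W => u; split; [apply: WP | apply: WE].
case/existsNP => u /not_implyP[Pu uW].
apply: (IH (W + <[u]>)%VS) => [w|].
  case/memv_addP => w1 w1W [_ /vlineP[c ->] ->].
  by rewrite addrC; apply: PD => //; apply: WP.
have : (\dim W < \dim (W + <[u]>))%N.
  rewrite ltn_neqAle dimvS ?addvSl // andbT; apply: contra_notN uW => /eqP e.
  have /eqP -> : W == (W + <[u]>)%VS by rewrite eqEdim addvSl e leqnn.
  by apply: subvP (addvSr _ _) _ (memv_line u).
have : (\dim (W + <[u]>) <= dim V)%N by rewrite -dimvf dimvS ?subvf.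
by move: dW; lia.
Qed.

End Subspaces.

Section Frames.
Variables (R : realType) (N : nat).
Local Notation C := R[i].

(** Duality: W is the annihilator of its annihilator. *)
Lemma separating_vector (W : {vspace 'rV[C]_N.+1}) (a : hcoord R N) : a \notin W ->
  exists w : hcoord R N, (forall u, u \in W -> dot u w = 0) /\ dot a w != 0.
Proof.
pose A := \matrix_(i < \dim W) (vbasis W)`_i.
have memA (u : 'rV[C]_N.+1) : u \in W -> (u <= A)%MS.
  move=> /coord_vbasis ->; apply: summx_sub => i _; apply: scalemx_sub.
  by rewrite -[(vbasis W)`_i](rowK (fun i => (vbasis W)`_i)); apply: row_sub.
have dotE (u : 'rV[C]_N.+1) j : dot u (col j (cokermx A))^T = (u *m cokermx A) ord0 j.
  by rewrite mxE; apply: eq_bigr => i _; rewrite !mxE.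
move=> aW; have : ~~ (a <= A)%MS.
  apply: contra aW => /submxP[D ->]; rewrite mulmx_sum_row.
  apply: rpred_sum => i _; apply: rpredZ; rewrite rowK.
  by apply: vbasis_mem; apply: mem_nth; rewrite size_tuple.
rewrite submxE => /eqP/rowP ne.
have [j nj] : exists j, (a *m cokermx A) ord0 j != 0.
  apply: contrapT => /forallNP no; apply: ne => j; rewrite [RHS]mxE.
  by apply/eqP; apply: contrapT => /negP; apply: no.
exists (col j (cokermx A))^T; split=> [u /memA|]; last by rewrite dotE.
by rewrite submxE dotE => /eqP ->; rewrite [LHS]mxE.
Qed.

(** Linear coordinates adapted to a point x and a linear space T that
    contains it: (l0, t) is the basis of the dual of T dual to (x, b), and s is a
    basis of the linear forms vanishing on T. *)
Record adapted_frame n k (x : hcoord R N) (T : {vspace 'rV[C]_N.+1})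
    (l0 : hcoord R N) (t b : 'I_n -> hcoord R N) (s : 'I_k -> hcoord R N) : Prop :=
  AdaptedFrame {
    frame_l0x : dot l0 x = 1;
    frame_l0b : forall i, dot l0 (b i) = 0;
    frame_tx : forall i, dot (t i) x = 0;
    frame_tb : forall i j, dot (t i) (b j) = (i == j)%:R;
    frame_xT : x \in T;
    frame_bT : forall i, b i \in T;
    frame_T : forall w, w \in T -> w = dot l0 w *: x + \sum_i dot (t i) w *: b i;
    frame_sT : forall j w, w \in T -> dot (s j) w = 0;
    frame_span : forall a, (forall w, w \in T -> dot a w = 0) ->
      exists g, a = \sum_j g j *: s j;
    frame_free : forall g, \sum_j g j *: s j = 0 -> forall j, g j = 0 }.

Lemma adapted_frame_exists n (x : hcoord R N) (T : {vspace 'rV[C]_N.+1}) :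
  x != 0 -> x \in T -> \dim T = n.+1 ->
  exists k l0 t b s, (k + n)%N = N /\ @adapted_frame n k x T l0 t b s.
Proof.
move=> x0 xT dT; pose U := (T :\: <[x]>)%VS.
have xsub : (<[x]> <= T)%VS by rewrite -memvE.
have dU : \dim U = n.
  have := dimv_cap_compl T <[x]>; rewrite (capv_idPr xsub) dim_vline x0 dT.
  by rewrite add1n => -[].
subst n; pose b (i : 'I_(\dim U)) : hcoord R N := (vbasis U)`_i.
pose c (i : 'I_(\dim U).+1) : hcoord R N := oapp b x (unlift ord0 i).
have c0 : c ord0 = x by rewrite /c unlift_none.
have cl i : c (lift ord0 i) = b i by rewrite /c liftK.
have UT : (U <= T)%VS by apply: diffvSl.
have bT i : b i \in T.
  by apply: (subvP UT); apply: vbasis_mem; apply: mem_nth; rewrite size_tuple.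
have cT i : c i \in T by rewrite /c; case: unliftP => [j|] _ /=; [apply: bT|].
have Tc w : w \in T -> exists g : 'rV[C]_(\dim U).+1, w = \sum_i g ord0 i *: c i.
  rewrite -(addv_diff_cap T <[x]>) (capv_idPr xsub).
  case/memv_addP => u uU [_ /vlineP[d ->] ->].
  exists (\row_i oapp (fun j => coord (vbasis U) j u) d (unlift ord0 i)).
  rewrite big_ord_recl mxE unlift_none c0 /= addrC; congr (_ + _).
  rewrite {1}(coord_vbasis uU); apply: eq_bigr => i _.
  by rewrite mxE liftK cl.
pose B := \matrix_(i < (\dim U).+1) c i.
have Bfree : row_free B.
  apply: inj_row_free => v; rewrite mulmx_sum_row.
  under eq_bigr => i _ do rewrite rowK.
  rewrite big_ord_recl c0 => e.
  have v0 : v ord0 ord0 = 0.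
    have : v ord0 ord0 *: x \in (U :&: <[x]>)%VS.
      rewrite memv_cap; apply/andP; split; last by rewrite rpredZ ?memv_line.
      move/eqP: e; rewrite addr_eq0 => /eqP ->; rewrite rpredN.
      apply: rpred_sum => i _; rewrite cl; apply: rpredZ.
      by apply: vbasis_mem; apply: mem_nth; rewrite size_tuple.
    by rewrite capv_diff memv0 scaler_eq0 (negPf x0) orbF => /eqP.
  move: e; rewrite v0 scale0r add0r.
  under eq_bigr => i _ do rewrite cl.
  have /freeP fr := basis_free (vbasisP U).
  move/(fr (fun i => v ord0 (lift ord0 i))) => vl.
  by apply/rowP => i; rewrite mxE; case: (unliftP ord0 i) => [j|] ->.
have /row_freeP[B' BB'] := Bfree.
pose d (j : 'I_(\dim U).+1) : hcoord R N := (col j B')^T.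
have dotdc j i : dot (d j) (c i) = (i == j)%:R.
  have /matrixP/(_ i j) := BB'; rewrite !mxE => <-; rewrite dotC.
  by apply: eq_bigr => l _; rewrite !mxE.
have dotsB (a : hcoord R N) i : dot a (c i) = (a *m B^T) ord0 i.
  by rewrite mxE; apply: eq_bigr => l _; rewrite !mxE.
pose K := kermx B^T.
exists (\rank K), (d ord0), (fun i => d (lift ord0 i)), b, (fun j => row j (row_base K)).
split.
  have /eqP rB := Bfree; have := rank_leq_col B.
  rewrite mxrank_ker mxrank_tr rB => ?.
  by rewrite subSS subnK.
split.
- by rewrite -c0 dotdc.
- by move=> i; rewrite -cl dotdc.
- by move=> i; rewrite -c0 dotdc.
- by move=> i j; rewrite -cl dotdc (inj_eq lift_inj) eq_sym.
- by [].
- exact: bT.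
- move=> w /Tc[g wE].
  have dw j : dot (d j) w = g ord0 j.
    rewrite wE dot_sumr (bigD1 j) //= big1 => [|i ij].
      by rewrite dotZr dotdc eqxx mulr1 addr0.
    by rewrite dotZr dotdc (negPf ij) mulr0.
  rewrite {1}wE big_ord_recl dw c0; congr (_ + _).
  by apply: eq_bigr => i _; rewrite dw cl.
- move=> j w /Tc[g ->]; rewrite dot_sumr big1 // => i _; rewrite dotZr dotsB.
  have /sub_kermxP -> : (row j (row_base K) <= K)%MS.
    by apply: submx_trans (row_sub _ _) _; rewrite eq_row_base.
  by rewrite mxE mulr0.
- move=> a aT; have : (a <= row_base K)%MS.
    rewrite eq_row_base; apply/sub_kermxP/rowP => i.
    by rewrite -dotsB mxE aT.
  by case/submxP => D ->; exists (fun j => D ord0 j); rewrite mulmx_sum_row.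
- move=> g e j; have : (\row_j g j) *m row_base K = 0.
    by rewrite mulmx_sum_row -[RHS]e; apply: eq_bigr => i _; rewrite mxE.
  move/eqP; rewrite mulmx_free_eq0 ?row_base_free // => /eqP/rowP/(_ j).
  by rewrite !mxE.
Qed.

(** The tangent space is defined as the annihilator of the differentials of the
    equations of X, so by duality these make up its annihilator. *)
Lemma conormal_differential (X : set (hcoord R N)) (x a : hcoord R N)
    (T : {vspace 'rV[C]_N.+1}) : (forall v, v \in T <-> tangent_cone X x v) ->
  (forall w, w \in T -> dot a w = 0) ->
  exists2 p, vanishing_ideal X p & forall w, peval (dirder w p) x = dot a w.
Proof.
move=> TX aT; have hI := vanishing_ideal_ideal X.
pose P (u : 'rV[C]_N.+1) := exists2 p, vanishing_ideal X p & forall w, peval (dirder w p) x = dot u w.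
have [|c u v [p Ip pu] [q Iq qv]|W WP] := @subspace_vspace _ _ P.
- by exists 0; [apply: (ideal0 hI) | move=> w; rewrite raddf0 peval0 dot0l].
- exists (c *: p + q); first by apply: (idealD hI) => //; apply: (idealZ _ hI).
  by move=> w; rewrite dirderD dirderZ pevalD pevalZ pu qv dotDl dotZl.
apply/WP; apply: contrapT => /negP /separating_vector [w [Ww]].
rewrite aT ?eqxx //; apply/TX => p Ip; rewrite -peval_dirder.
pose u : 'rV[C]_N.+1 := \row_i peval p^`M(i) x.
have pu v : peval (dirder v p) x = dot u v.
  by rewrite peval_dirder; apply: eq_bigr => i _; rewrite mxE.
by rewrite pu; apply: Ww; apply/WP; exists p.
Qed.

End Frames.

(** * Third-order expansion of X at a point *)

Section LocalExpansion.
Variables (R : realType) (N n k : nat).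
Local Notation C := R[i].
Variables (X : set (hcoord R N)) (x : hcoord R N) (T : {vspace 'rV[C]_N.+1}).
Variables (l0 : hcoord R N) (t b : 'I_n -> hcoord R N) (s : 'I_k -> hcoord R N).
Hypothesis Xx : X x.
Hypothesis TX : forall v, v \in T <-> tangent_cone X x v.
Hypothesis fr : adapted_frame x T l0 t b s.
Implicit Types (p q l : form R N).

Local Notation I := (vanishing_ideal X).
Local Notation u := (linform l0 - 1).
Local Notation tl i := (linform (t i)).

Let hI : is_ideal I := vanishing_ideal_ideal X.

(** Equations of X near x modulo order d, in the affine chart l0 = 1. *)
Definition local_ideal d : set (form R N) :=
  [set p | exists i h q, [/\ I i, mpow x d q & p = i + h * u + q]].

Lemma local_ideal_ideal d : is_ideal (local_ideal d).
Proof.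
have hm := mpow_ideal x d; split.
- by exists 0, 0, 0; split; [apply: (ideal0 hI) | apply: (ideal0 hm) | rewrite mul0r !addr0].
- move=> _ _ [i [h [q [Ii mq ->]]]] [i' [h' [q' [Ii' mq' ->]]]].
  exists (i + i'), (h + h'), (q + q').
  by split; [apply: (idealD hI) | apply: (idealD hm) | ring].
- move=> p _ [i [h [q [Ii mq ->]]]]; exists (p * i), (p * h), (p * q).
  by split; [apply: (idealMl _ hI) | apply: (idealMl _ hm) | ring].
Qed.

Lemma local_ideal_eqn d p : I p -> local_ideal d p.
Proof.
by move=> Ip; exists p, 0, 0; split=> //; [apply: (ideal0 (mpow_ideal x d)) | rewrite mul0r !addr0].
Qed.

Lemma local_ideal_chart d : local_ideal d u.
Proof.
exists 0, 1, 0; split; [exact: (ideal0 hI) | exact: (ideal0 (mpow_ideal x d)) |].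
by rewrite mul1r add0r addr0.
Qed.

Lemma local_ideal_mpow d p : mpow x d p -> local_ideal d p.
Proof.
by move=> mp; exists 0, 0, p; split=> //; [apply: (ideal0 hI) | rewrite mul0r !add0r].
Qed.

Lemma local_idealM d e p q : local_ideal d p -> mpow x e q -> local_ideal (d + e) (p * q).
Proof.
move=> [i [h [r [Ii mr ->]]]] mq; exists (i * q), (h * q), (r * q).
by split; [apply: (idealMr _ hI) | apply: mpowM | ring].
Qed.

(** Forms of degree d in the coordinates of the tangent space. *)
Fixpoint tangent_form d : set (form R N) :=
  if d is d'.+1 then [set p | exists2 q : 'I_n -> form R N,
    (forall i, tangent_form d' (q i)) & p = \sum_i tl i * q i]
  else [set p | exists c, p = c%:MP].

Lemma tangent_formD d p q : tangent_form d p -> tangent_form d q -> tangent_form d (p + q).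
Proof.
elim: d p q => [|d IH] p q; first by move=> [c ->] [c' ->]; exists (c + c'); rewrite mpolyCD.
move=> [f fd ->] [g gd ->]; exists (fun i => f i + g i); first by move=> i; apply: (IH _ _ (fd i) (gd i)).
by rewrite -big_split; apply: eq_bigr => i _; rewrite mulrDr.
Qed.

Lemma tangent_formZ d c p : tangent_form d p -> tangent_form d (c *: p).
Proof.
elim: d p => [|d IH] p; first by move=> [c' ->]; exists (c * c'); rewrite mpolyCM mul_mpolyC.
move=> [f fd ->]; exists (fun i => c *: f i); first by move=> i; apply: (IH _ (fd i)).
by rewrite scaler_sumr; apply: eq_bigr => i _; rewrite scalerAr.
Qed.

Lemma tangent_form0 d : tangent_form d 0.
Proof.
elim: d => [|d IH]; first by exists 0; rewrite mpolyC0.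
by exists (fun=> 0) => //; rewrite big1 // => i _; rewrite mulr0.
Qed.

Lemma tangent_formM d p q : tangent_form 1 p -> tangent_form d q -> tangent_form d.+1 (p * q).
Proof.
move=> [f fc ->] hq; exists (fun i => f i * q); last first.
  by rewrite mulr_suml; apply: eq_bigr => i _; rewrite mulrA.
by move=> i; have [c ->] := fc i; rewrite mul_mpolyC; apply: tangent_formZ.
Qed.

Lemma peval_tl i : peval (tl i) x = 0.
Proof. by rewrite peval_linform (frame_tx fr). Qed.

Lemma tangent_form_mpow d p : tangent_form d p -> mpow x d p.
Proof.
elim: d p => [|d IH] p; first by move=> _; apply: mpow0.
move=> [f fd ->]; apply: (ideal_sum _ (mpow_ideal x d.+1)) => i _.
by apply: (@mpowM _ _ x 1 d); [exact: (mpow1 (peval_tl i)) | exact: (IH _ (fd i))].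
Qed.

(** Subtracting from p suitable multiples of l0 - 1 and of the t_i leaves a
    polynomial whose differential at x vanishes on T, and such a differential is
    that of an equation of X. *)
Lemma cotangent_split p : peval p x = 0 ->
  exists2 l, tangent_form 1 l & local_ideal 2 (p - l).
Proof.
move=> p0; pose a : hcoord R N := \row_i peval p^`M(i) x.
have da w : peval (dirder w p) x = dot a w.
  by rewrite peval_dirder; apply: eq_bigr => i _; rewrite mxE.
pose c i := dot a (b i).
pose l := \sum_i c i *: tl i.
pose a' : hcoord R N := a - (dot a x *: l0 + \sum_i c i *: t i).
have da' w : dot a' w = dot a w - (dot a x * dot l0 w + \sum_i c i * dot (t i) w).
  rewrite /a' -scaleN1r dotDl dotZl mulN1r dotDl dotZl dot_suml.
  by congr (_ - (_ + _)); apply: eq_bigr => i _; rewrite dotZl.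
have [|P IP dP] := conormal_differential (a := a') TX.
  move=> w /(frame_T fr) wE; rewrite da' {1}wE dotDr dotZr dot_sumr.
  rewrite mulrC [X in _ + X - _](_ : _ = \sum_i c i * dot (t i) w) ?subrr //.
  by apply: eq_bigr => i _; rewrite dotZr mulrC.
exists l.
  exists (fun i => (c i)%:MP) => [i|]; first by exists (c i).
  by apply: eq_bigr => i _; rewrite mulrC mul_mpolyC.
exists P, (dot a x)%:MP, (p - l - P - (dot a x)%:MP * u); split=> //; last by ring.
apply: mpow2 => [|w].
  rewrite !pevalB pevalM pevalB peval_linform (frame_l0x fr) peval1 subrr mulr0 subr0.
  rewrite p0 (IP x Xx) subr0 /l peval_sum big1 ?subrr // => i _.
  by rewrite pevalZ peval_tl mulr0.
rewrite mul_mpolyC !dirderB dirderZ dirderB dirder1 subr0 !pevalB pevalZ.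
rewrite dirder_linform [peval _%:MP _]mevalC da dP da' /l dirder_sum peval_sum.
rewrite (eq_bigr (fun i => c i * dot (t i) w)) => [|i _].
  by set S := \sum_i _; set D := dot l0 w; ring.
by rewrite dirderZ pevalZ dirder_linform [peval _%:MP _]mevalC.
Qed.

(** A product of d polynomials vanishing at x is, to first order, the product of
    their tangential linear parts. *)
Lemma mpow_split d q : mpow x d q ->
  exists2 l, tangent_form d l & local_ideal d.+1 (q - l).
Proof.
elim: d q => [|d IH] q mq.
  exists (peval q x)%:MP; first by exists (peval q x).
  by apply: local_ideal_mpow; apply: mpow1; rewrite pevalB [peval _%:MP _]mevalC subrr.
have hL := local_ideal_ideal d.+2; have hm := mpow_ideal x d.+1.
suff [] : [set q | mpow x d.+1 q /\
    exists2 l, tangent_form d.+1 l & local_ideal d.+2 (q - l)] q by [].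
apply: mq.
  split; first split; first exact: (ideal0 hm).
  - by exists 0; [apply: tangent_form0 | rewrite subrr; apply: (ideal0 hL)].
  - move=> p r [mp [l hl pl]] [mr [l' hl' rl']]; split; first exact: (idealD hm).
    exists (l + l'); first exact: tangent_formD.
    by rewrite opprD addrACA; apply: (idealD hL).
  - move=> p r [mr [l hl rl]]; split; first exact: (idealMl _ hm).
    exists (peval p x *: l); first exact: tangent_formZ.
    rewrite (_ : p * r - _ = (p - (peval p x)%:MP) * r + (peval p x)%:MP * (r - l)).
      apply: (idealD hL); last exact: (idealMl _ hL).
      apply: local_ideal_mpow; apply: (@mpowM _ _ x 1 d.+1) => //; apply: mpow1.
      by rewrite pevalB [peval _%:MP _]mevalC subrr.
    by rewrite -mul_mpolyC; ring.
move=> [|a r] //= [rd] s0; split.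
  by rewrite -rd; apply: (mpow_prod (s := a :: r)).
have a0 : peval a x = 0 by apply: s0; rewrite inE eqxx.
have mr : mpow x d (\prod_(a <- r) a).
  by rewrite -rd; apply: mpow_prod => c cr; apply: s0; rewrite inE cr orbT.
rewrite big_cons; have [l hl al] := cotangent_split a0; have [l' hl' rl'] := IH _ mr.
exists (l * l'); first exact: tangent_formM.
set Q := \prod_(_ <- _) _ in mr rl' *.
rewrite (_ : a * Q - l * l' = (a - l) * Q + (Q - l') * l); last by ring.
apply: (idealD hL); first by have := local_idealM al mr; rewrite add2n.
by have := local_idealM rl' (tangent_form_mpow hl); rewrite addn1.
Qed.

(** A normal coordinate has the same differential at x as an equation of X, so on X
    it lies in the square of the maximal ideal; two further splittings produce its
    quadratic and cubic parts. *)
Lemma normal_expansion j : exists (c2 : 'I_n -> 'I_n -> C) (c3 : 'I_n -> 'I_n -> 'I_n -> C),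
  local_ideal 4 (linform (s j) - \sum_i \sum_h c2 i h *: (tl i * tl h)
    - \sum_i \sum_h \sum_g c3 i h g *: (tl i * (tl h * tl g))).
Proof.
have [|P IP dP] := conormal_differential (a := s j) TX.
  by move=> w; apply: (frame_sT fr).
have m2 : mpow x 2 (linform (s j) - P).
  apply: mpow2 => [|w].
    by rewrite pevalB peval_linform (frame_sT fr _ (frame_xT fr)) (IP x Xx) subrr.
  by rewrite dirderB pevalB dP dirder_linform [peval _%:MP _]mevalC subrr.
have [l2 hl2 [P' [a [q [IP' m3 e2]]]]] := mpow_split m2.
have [l3 hl3 L4] := mpow_split m3.
have quadratic p : tangent_form 2 p ->
    exists c2 : 'I_n -> 'I_n -> C, p = \sum_i \sum_h c2 i h *: (tl i * tl h).
  move=> [f fd ->]; have /choice[c cP] i : exists c : 'I_n -> C, f i = \sum_h c h *: tl h.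
    have [f' f'd ->] := fd i; have [c cE] := choice f'd; exists c.
    by apply: eq_bigr => h _; rewrite cE mulrC mul_mpolyC.
  exists c; apply: eq_bigr => i _; rewrite cP mulr_sumr.
  by apply: eq_bigr => h _; rewrite scalerAr.
have [c2 E2] := quadratic _ hl2; have [f fd E3] := hl3.
have [c3 E3'] := choice (fun i => quadratic _ (fd i)).
exists c2, c3; rewrite -E2.
rewrite (_ : \sum_i \sum_h \sum_g _ = l3); last first.
  rewrite E3; apply: eq_bigr => i _; rewrite E3' mulr_sumr; apply: eq_bigr => h _.
  by rewrite mulr_sumr; apply: eq_bigr => g _; rewrite scalerAr.
have -> : linform (s j) - l2 - l3 = P + P' + a * u + (q - l3).
  by move/(congr1 (fun z => z + P)): e2; rewrite addrAC subrK => ->; ring.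
have hL := local_ideal_ideal 4.
apply: (idealD hL) => //; apply: (idealD hL); last by apply: (idealMl _ hL); apply: local_ideal_chart.
by apply: local_ideal_eqn; apply: (idealD hI).
Qed.

End LocalExpansion.

(** * Homogeneous ideals and the affine chart *)

Section Graded.
Variables (R : realType) (N : nat).
Local Notation C := R[i].
Implicit Types (p q l : form R N) (x a : hcoord R N) (J A : set (form R N)).

Lemma pihomogMl d e p q : p \is e.-homog ->
  pihomog mdeg d (p * q) = if (e <= d)%N then p * pihomog mdeg (d - e) q else 0.
Proof.
move=> hp; case: leqP => ed.
  apply: (@mpartM _ _ (fun m => mdeg m == d) (fun m => mdeg m == d - e)%N).
  move=> m m' pm; rewrite mdegD; have /= -> := dhomog_mf hp pm.
  by rewrite -{1}(subnKC ed) eqn_add2l.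
have := @mpartM _ _ (fun m => mdeg m == d) pred0 p q; rewrite /pihomog /mpart => ->.
  by rewrite big_pred0 ?mulr0.
move=> m m' pm; rewrite mdegD; have /= -> := dhomog_mf hp pm.
by apply/eqP; lia.
Qed.

Lemma ideal_square_mul A p q : A p -> A q -> ideal_square A (p * q).
Proof.
by move=> Ap Aq; exists 1%N, (fun=> p), (fun=> q); split=> //; rewrite big_ord1.
Qed.

Lemma ideal_square_ideal A : is_ideal A -> is_ideal (ideal_square A).
Proof.
move=> hA; split.
- by exists 0%N, (fun=> 0), (fun=> 0); split=> [[]|]; rewrite ?big_ord0.
- move=> _ _ [d [a [b [ab ->]]]] [d' [a' [b' [ab' ->]]]].
  exists (d + d')%N, (fun i => match fintype.split i with inl j => a j | inr j => a' j end),
    (fun i => match fintype.split i with inl j => b j | inr j => b' j end).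
  split; first by move=> i; case: fintype.split.
  rewrite big_split_ord /=; congr (_ + _); apply: eq_bigr => i _.
    by rewrite (unsplitK (inl i)).
  by rewrite (unsplitK (inr i)).
- move=> p _ [d [a [b [ab ->]]]]; exists d, (fun i => p * a i), b.
  split; first by move=> i; have [Aa Ab] := ab i; split=> //; apply: (idealMl _ hA).
  by rewrite mulr_sumr; apply: eq_bigr => i _; rewrite mulrA.
Qed.

Lemma ideal_square_homogeneous A :
  is_ideal A -> is_homogeneous A -> is_homogeneous (ideal_square A).
Proof.
move=> hA gA _ d [k [a [b [ab ->]]]]; have hA2 := ideal_square_ideal hA.
rewrite raddf_sum; apply: (ideal_sum _ hA2) => i _ /=; have [Aa Ab] := ab i.
rewrite {1}(form_components (a i)) mulr_suml raddf_sum.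
apply: (ideal_sum _ hA2) => e _ /=; rewrite (pihomogMl _ _ (pihomogP _ _ _)).
case: ifP => _; last exact: (ideal0 hA2).
by apply: ideal_square_mul; apply: gA.
Qed.

Definition ideal_add A J : set (form R N) :=
  [set p | exists q r, [/\ A q, J r & p = q + r]].

Lemma ideal_add_ideal A J : is_ideal A -> is_ideal J -> is_ideal (ideal_add A J).
Proof.
move=> hA hJ; split.
- by exists 0, 0; split; [apply: (ideal0 hA) | apply: (ideal0 hJ) | rewrite addr0].
- move=> _ _ [q [r [Aq Jr ->]]] [q' [r' [Aq' Jr' ->]]]; exists (q + q'), (r + r').
  by split; [apply: (idealD hA) | apply: (idealD hJ) | rewrite addrACA].
- move=> p _ [q [r [Aq Jr ->]]]; exists (p * q), (p * r).
  by split; [apply: (idealMl _ hA) | apply: (idealMl _ hJ) | rewrite mulrDr].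
Qed.

Lemma ideal_add_homogeneous A J :
  is_homogeneous A -> is_homogeneous J -> is_homogeneous (ideal_add A J).
Proof.
move=> gA gJ _ d [q [r [Aq Jr ->]]]; exists (pihomog mdeg d q), (pihomog mdeg d r).
by split; [apply: gA | apply: gJ | rewrite raddfD].
Qed.

Definition principal u : set (form R N) := [set p | exists h, p = h * u].

Lemma principal_ideal u : is_ideal (principal u).
Proof.
split; first by exists 0; rewrite mul0r.
  by move=> _ _ [h ->] [h' ->]; exists (h + h'); rewrite mulrDl.
by move=> p _ [h ->]; exists (p * h); rewrite mulrA.
Qed.

Variable l0 : hcoord R N.
Local Notation L0 := (linform l0).

(** A linear form that vanishes on the part of a subscheme in the chart l0 = 1
    satisfies its homogeneous equations after multiplication by a power of l0:
    compare homogeneous components. *)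
Lemma homogenize_membership J l : is_ideal J -> is_homogeneous J -> l \is 1.-homog ->
  ideal_add J (principal (L0 - 1)) l -> exists d, J (L0 ^+ d * l).
Proof.
move=> hJ gJ hl [g [_ [Jg [h ->] lE]]].
have comp d : pihomog mdeg d l = pihomog mdeg d g
    + ((if (0 < d)%N then L0 * pihomog mdeg d.-1 h else 0) - pihomog mdeg d h).
  rewrite lE raddfD /= mulrC mulrBl mul1r raddfB /=.
  by rewrite (pihomogMl _ _ (linform_homog l0)) subn1.
have J0 : J (pihomog mdeg 0 h).
  have := comp 0%N; rewrite (pihomog_ne0 (d := 1%N)) //= sub0r => e.
  have -> : pihomog mdeg 0 h = pihomog mdeg 0 g.
    by apply/eqP; rewrite -subr_eq0 -oppr_eq0 opprB -e.
  exact: gJ.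
have Jd d : J (pihomog mdeg d.+1 h + L0 ^+ d * l).
  elim: d => [|d IH].
    have := comp 1%N; rewrite pihomog_dE //= => e.
    rewrite expr0 mul1r e (_ : _ + _ = pihomog mdeg 1 g + L0 * pihomog mdeg 0 h); last by ring.
    by apply: (idealD hJ); [apply: gJ | apply: (idealMl _ hJ)].
  have := comp d.+2; rewrite (pihomog_ne0 (d := 1%N)) //= => e.
  rewrite (_ : _ + _ = pihomog mdeg d.+2 g + L0 * (pihomog mdeg d.+1 h + L0 ^+ d * l)).
    by apply: (idealD hJ); [apply: gJ | apply: (idealMl _ hJ)].
  have -> : pihomog mdeg d.+2 h = pihomog mdeg d.+2 g + L0 * pihomog mdeg d.+1 h.
    by apply/eqP; rewrite -subr_eq0 -oppr_eq0 opprB -addrA -e.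
  by rewrite exprS; ring.
exists (msize h); have := Jd (msize h).
rewrite (_ : pihomog mdeg (msize h).+1 h = 0) ?add0r //.
rewrite pihomogE big_seq_cond big1 // => m /andP[hm /eqP /= md].
by have := msize_mdeg_lt hm; rewrite md ltnNge leqnSn.
Qed.

Variable x : hcoord R N.

(** These linear forms span the ideal of x when l0 x = 1, as they express the
    variables in terms of l0 up to elements of it. *)
Definition shift i : form R N := 'X_i - x ord0 i *: L0.

(** Write each variable of the monomial as x_i l0 + shift i and expand: every term
    has at least d factors l0 or at least e factors shift i. *)
Lemma monomial_membership J d e f (m : 'X_{1..N.+1}) p : is_ideal J ->
    (d + e <= (mdeg m).+1)%N -> mdeg m = f -> J (L0 ^+ d * p) ->
    (forall s : seq 'I_N.+1, size s = e -> J (\prod_(i <- s) shift i * p)) ->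
  J ('X_[m] * p).
Proof.
move=> hJ + mf; rewrite mf; elim: f d e m p mf => [|f IH] d e m p mf de Jd Je.
  have [d0|e0] : d = 0%N \/ e = 0%N by lia.
    by apply: (idealMl _ hJ); move: Jd; rewrite d0 expr0 mul1r.
  by apply: (idealMl _ hJ); have := Je [::]; rewrite big_nil mul1r; apply.
have [i mi] : exists i, m i != 0%N.
  apply: contrapT => /forallNP no; have : mdeg m = 0%N.
    by rewrite mdegE big1 // => i _; apply/eqP; apply: contrapT => /negP; apply: no.
  by rewrite mf.
have m'E : m = (U_(i) + (m - U_(i)))%MM by rewrite addmC submK // lep1mP.
set m' := (m - U_(i))%MM in m'E; have m'f : mdeg m' = f.
  by move: mf; rewrite m'E mdegD mdeg1 => -[].
rewrite m'E mpolyXD.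
have -> : 'X_i * 'X_[m'] * p = x ord0 i *: ('X_[m'] * (L0 * p)) + 'X_[m'] * (shift i * p).
  by rewrite /shift -!mul_mpolyC; ring.
apply: (idealD hJ); first apply: (idealZ _ hJ).
  case: d de Jd => [|d] de Jd.
    by do 2 apply: (idealMl _ hJ); move: Jd; rewrite expr0 mul1r.
  apply: (IH d e) => //; first by rewrite mulrA -exprSr.
  by move=> s se; rewrite mulrCA; apply: (idealMl _ hJ); apply: Je.
case: e de Je => [|e] de Je.
  by do 2 apply: (idealMl _ hJ); have := Je [::]; rewrite big_nil mul1r; apply.
apply: (IH d e) => //; first by lia.
  by rewrite mulrCA; apply: (idealMl _ hJ).
move=> s se; rewrite mulrA mulrAC -mulrA.
by have := Je (i :: s); rewrite /= se big_cons mulrA [_ * p]mulrC mulrA mulrC mulrA; apply.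
Qed.

(** Membership at the point x, where l0 is invertible, is enough to be in the
    saturation when the subscheme defined by J is supported at x. *)
Lemma saturation_membership J d e p : is_ideal J -> J (L0 ^+ d * p) ->
    (forall s : seq 'I_N.+1, size s = e -> J (\prod_(i <- s) shift i)) ->
  saturation J p.
Proof.
move=> hJ Jd Je; exists (d + e)%N => q hq.
rewrite [q]mpolyE mulr_suml big_seq; apply: (ideal_sum _ hJ) => m qm.
rewrite -scalerAl; apply: (idealZ _ hJ).
apply: (@monomial_membership _ d e _ _ _ hJ _ erefl) => //.
  by have /= -> := dhomog_mf hq qm.
by move=> s se; apply: (idealMr _ hJ); apply: Je.
Qed.

End Graded.

(** * The subscheme of length two at a point in a given direction *)

Lemma linear_pair (K : nzRingType) (U : lmodType K) (f g : U -> K) :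
  linear_for *%R f -> linear_for *%R g ->
  linear (fun p => \row_(i < 2) if i == ord0 then f p else g p).
Proof.
move=> flin glin c p q; apply/rowP => i; rewrite !mxE.
by case: ifP => _; [apply: flin | apply: glin].
Qed.

Section TangentVector.
Variables (R : realType) (N : nat).
Local Notation C := R[i].
Variables (x V l0 tau : hcoord R N).
Hypotheses (l0x : dot l0 x = 1) (l0V : dot l0 V = 0).
Hypotheses (taux : dot tau x = 0) (tauV : dot tau V = 1).
Implicit Types (p q : form R N) (X : set (hcoord R N)).
Local Notation L0 := (linform l0).
Local Notation u := (L0 - 1).

(** The homogeneous ideal of the point x with the tangent vector V; the conditions
    are imposed at all multiples of x in order to be stable under taking
    homogeneous components. *)
Definition tvec_ideal : set (form R N) := [set p | forall c, c != 0 ->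
  peval p (c *: x) = 0 /\ peval (dirder V p) (c *: x) = 0].

Lemma tvec_ideal_ideal : is_ideal tvec_ideal.
Proof.
split=> [c _|p q hp hq c c0|p q hq c c0].
- by rewrite raddf0 !peval0.
- have [p0 dp0] := hp c c0; have [q0 dq0] := hq c c0.
  by rewrite dirderD !pevalD p0 q0 dp0 dq0 !addr0.
- have [q0 dq0] := hq c c0.
  by rewrite pevalM peval_dirderM q0 dq0 !mulr0 addr0.
Qed.

Lemma tvec_ideal_homog d p : p \is d.-homog -> peval p x = 0 ->
  peval (dirder V p) x = 0 -> tvec_ideal p.
Proof.
move=> hp p0 dp0 c c0; rewrite (peval_homog _ _ hp) p0 mulr0.
by rewrite (peval_homog _ _ (dirder_homog V hp)) dp0 mulr0.
Qed.

Lemma tvec_ideal_component p d : tvec_ideal p ->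
  peval (pihomog mdeg d p) x = 0 /\ peval (dirder V (pihomog mdeg d p)) x = 0.
Proof.
move=> hp; split; first by apply: peval_components => c /hp[].
case: d => [|d]; first by rewrite dirder_component0 peval0.
by rewrite -dirder_component; apply: peval_components => c /hp[].
Qed.

Lemma tvec_ideal_homogeneous : is_homogeneous tvec_ideal.
Proof.
move=> p d /(tvec_ideal_component d)[p0 dp0].
exact: tvec_ideal_homog (pihomogP _ _ _) p0 dp0.
Qed.

Lemma tvec_ideal_saturated : saturation tvec_ideal `<=` tvec_ideal.
Proof.
move=> p [d hp] c c0.
have hL : L0 ^+ d \is d.-homog by rewrite -[d in d.-homog]mul1n dhomogMn ?linform_homog.
have [] := hp _ hL c c0; rewrite pevalM peval_dirderM pevalX peval_linform dotZr l0x mulr1.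
have cd0 : c ^+ d != 0 by rewrite expf_neq0.
move/eqP; rewrite mulf_eq0 (negPf cd0) /= => /eqP ->; rewrite mulr0 add0r.
by move/eqP; rewrite mulf_eq0 (negPf cd0) /= => /eqP ->.
Qed.

Definition tvec_scheme : closed_subscheme R N :=
  ClosedSubscheme tvec_ideal_ideal tvec_ideal_homogeneous tvec_ideal_saturated.

Lemma tvec_scheme_of X : zariski_closed X -> X x -> tangent_cone X x V ->
  subscheme_of tvec_scheme X.
Proof.
move=> cX Xx tV p Ip; have gI := vanishing_ideal_homogeneous cX.
rewrite /= [p]form_components; apply: (ideal_sum _ tvec_ideal_ideal) => d _.
have Id := gI p d Ip; apply: tvec_ideal_homog (pihomogP _ _ _) (Id x Xx) _.
by rewrite peval_dirder; apply: tV.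
Qed.

Lemma dirder_L0 d : peval (dirder V (L0 ^+ d)) x = 0.
Proof.
elim: d => [|d IH]; first by rewrite expr0 dirder1 peval0.
rewrite exprS peval_dirderM IH mulr0 addr0 dirder_linform l0V.
by rewrite mpolyC0 peval0 mul0r.
Qed.

(** In degree d > 0, the forms l0^d and l0^(d-1) tau show that the value at x and
    the derivative along V are independent conditions. *)
Lemma tvec_scheme_length : has_length tvec_scheme 2.
Proof.
exists 1%N => d d_gt0.
pose ev (p : dhomog N.+1 C d) : 'rV[C]_2 :=
  \row_(i < 2) if i == ord0 then peval p x else peval (dirder V p) x.
have ev_lin : linear ev.
  apply: linear_pair => c p q; first by rewrite [LHS]pevalD pevalZ.
  by rewrite [dirder V _]dirderD dirderZ pevalD pevalZ.
pose evL : {linear dhomog N.+1 C d -> 'rV[C]_2} :=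
  HB.pack ev (GRing.isLinear.Build _ _ _ _ ev ev_lin).
pose f := linfun evL.
exists (lker f).
  move=> p; rewrite memv_ker lfunE /=; split=> [/eqP/rowP e|Sp].
    have := e ord0; have := e (lift ord0 ord0); rewrite !mxE /= => dp0 p0.
    exact: tvec_ideal_homog (dhomog_is_dhomog p) p0 dp0.
  have [p0 dp0] := tvec_ideal_component d Sp; move: p0 dp0.
  rewrite pihomog_dE ?dhomog_is_dhomog // => p0 dp0.
  by apply/eqP/rowP => i; rewrite !mxE p0 dp0 if_same.
rewrite -(limg_ker_dim f fullv) capfv; congr (_ + _)%N.
have -> : limg f = fullv.
  apply/vspaceP => w; rewrite memvf.
  pose p : form R N := w ord0 ord0 *: L0 ^+ d
    + w ord0 (lift ord0 ord0) *: (L0 ^+ d.-1 * linform tau).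
  have hL e : L0 ^+ e \is e.-homog.
    by rewrite -[e in e.-homog]mul1n dhomogMn ?linform_homog.
  have hp : p \is d.-homog.
    apply: rpredD; apply: rpredZ; first exact: hL.
    by have := dhomogM (hL d.-1) (linform_homog tau); rewrite addn1 prednK.
  have -> : w = f (DHomog hp); last by rewrite memv_img ?memvf.
  rewrite lfunE /=; apply/rowP => i; rewrite !mxE /= /p.
  case: (unliftP ord0 i) => [j|] -> /=.
    rewrite (ord1 j) peval_dirderD dirder_L0 mulr0 add0r.
    rewrite peval_dirderM dirder_L0 mul0r add0r pevalX !peval_linform.
    by rewrite l0x expr1n mul1r dirder_linform tauV mpolyC1 peval1 mulr1.
  rewrite pevalD !pevalZ pevalM !pevalX !peval_linform l0x taux.
  by rewrite !expr1n !mulr1 !mulr0 addr0.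
by rewrite dimvf /dim /=.
Qed.

(** Homogenizing p with powers of l0 changes neither its value at x nor its
    derivative along V, because l0 is 1 at x and constant along V. *)
Lemma tvec_chart p : peval p x = 0 -> peval (dirder V p) x = 0 ->
  ideal_add tvec_ideal (principal u) p.
Proof.
move=> p0 dp0; set K := ideal_add _ _.
have hK : is_ideal K := ideal_add_ideal tvec_ideal_ideal (principal_ideal u).
have Ku : K (L0 - 1).
  by exists 0, u; split; [apply: (ideal0 tvec_ideal_ideal) | exists 1; rewrite mul1r | rewrite add0r].
pose D := msize p.
pose g := \sum_(d < D) L0 ^+ (D - d) * pihomog mdeg d p.
have hL e : L0 ^+ e \is e.-homog.
  by rewrite -[e in e.-homog]mul1n dhomogMn ?linform_homog.
have hg : g \is D.-homog.
  apply: rpred_sum => d _.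
  by have := dhomogM (hL (D - d)%N) (pihomogP mdeg d p); rewrite subnK // ltnW.
have gx : peval g x = peval p x.
  rewrite [p in RHS]form_components /g !peval_sum; apply: eq_bigr => d _.
  by rewrite pevalM pevalX peval_linform l0x expr1n mul1r.
have dgx : peval (dirder V g) x = peval (dirder V p) x.
  rewrite [p in RHS]form_components /g !dirder_sum !peval_sum; apply: eq_bigr => d _.
  rewrite peval_dirderM dirder_L0 mul0r add0r.
  by rewrite pevalX peval_linform l0x expr1n mul1r.
have -> : p = g - (g - p) by rewrite opprB addrC subrK.
apply: (idealB hK).
  exists g, 0; split; last by rewrite addr0.
    by apply: tvec_ideal_homog hg _ _; rewrite ?gx ?dgx.
  exact: (ideal0 (principal_ideal u)).
rewrite [X in g - X]form_components /g -sumrB; apply: (ideal_sum _ hK) => d _.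
rewrite -[X in _ - X]mul1r -mulrBl; apply: (idealMr _ hK).
by rewrite -(expr1n _ (D - d)); apply: ideal_congX.
Qed.

Section Double.
Variable X : set (hcoord R N).
Hypothesis cX : zariski_closed X.

Local Notation I := (vanishing_ideal X).
Let J := ideal_add (ideal_square tvec_ideal) I.
Let hI : is_ideal I := vanishing_ideal_ideal X.
Let hS2 : is_ideal (ideal_square tvec_ideal) := ideal_square_ideal tvec_ideal_ideal.
Let hJ : is_ideal J := ideal_add_ideal hS2 hI.

(** The ideal of the doubled subscheme in the chart l0 = 1. *)
Definition double_chart : set (form R N) := ideal_add J (principal u).

Lemma double_chart_ideal : is_ideal double_chart.
Proof. exact: ideal_add_ideal hJ (principal_ideal u). Qed.

Lemma double_chart_eqn p : I p -> double_chart p.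
Proof.
move=> Ip; exists p, 0; split; last by rewrite addr0.
  by exists 0, p; split; [apply: (ideal0 hS2) | | rewrite add0r].
exact: (ideal0 (principal_ideal u)).
Qed.

Lemma double_chart_unit : double_chart u.
Proof.
by exists 0, u; split; [apply: (ideal0 hJ) | exists 1; rewrite mul1r | rewrite add0r].
Qed.

Lemma double_chart_square p q : tvec_ideal p -> tvec_ideal q -> double_chart (p * q).
Proof.
move=> hp hq; exists (p * q), 0; split; last by rewrite addr0.
  exists (p * q), 0; split; [exact: ideal_square_mul | exact: (ideal0 hI) |].
  by rewrite addr0.
exact: (ideal0 (principal_ideal u)).
Qed.

(** A product of two polynomials vanishing at x belongs to the ideal of the
    subscheme, so a product of four belongs to its square. *)
Lemma double_chart_mpow4 p : mpow x 4 p -> double_chart p.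
Proof.
move=> mp; apply: mp; first exact: double_chart_ideal.
case=> [//|a1 [//|a2 [//|a3 [//|a4 [|//]]]]] _ s0.
have two p1 p2 : peval p1 x = 0 -> peval p2 x = 0 ->
    ideal_add tvec_ideal (principal u) (p1 * p2).
  by move=> z1 z2; apply: tvec_chart; rewrite ?peval_dirderM ?pevalM z1 z2 ?mul0r ?mulr0 ?addr0.
have z a : a \in [:: a1; a2; a3; a4] -> peval a x = 0 by apply: s0.
have [|| g [_ [Sg [h ->] e]]] := two a1 a2; try by apply: z; rewrite !inE eqxx ?orbT.
have [|| g' [_ [Sg' [h' ->] e']]] := two a3 a4; try by apply: z; rewrite !inE eqxx ?orbT.
rewrite !big_cons big_nil mulr1 mulrA e e'.
have hD := double_chart_ideal.
have -> : (g + h * u) * (g' + h' * u) = g * g' + (g * h' + h * (g' + h' * u)) * u by ring.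
apply: (idealD hD); first exact: double_chart_square.
by apply: (idealMl _ hD); apply: double_chart_unit.
Qed.

(** Homogenize, and note that products of four shifts are in the square of the
    ideal of the subscheme since products of two are in the ideal. *)
Lemma double_chart_sound l : l \is 1.-homog -> double_chart l ->
  double_ideal X tvec_scheme l.
Proof.
move=> hl Dl; have gJ : is_homogeneous J.
  apply: ideal_add_homogeneous; last exact: vanishing_ideal_homogeneous.
  exact: ideal_square_homogeneous tvec_ideal_ideal tvec_ideal_homogeneous.
have [d Jd] := homogenize_membership hJ gJ hl Dl.
apply: (@saturation_membership _ _ l0 x J d 4 l hJ Jd).
case=> [//|i1 [//|i2 [//|i3 [//|i4 [|//]]]]] _.
have sh i : shift l0 x i \is 1.-homog.
  apply: rpredB; first by rewrite dhomogX /= mdeg1.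
  by apply: rpredZ; apply: linform_homog.
have sh0 i : peval (shift l0 x i) x = 0.
  by rewrite pevalB pevalZ peval_linform l0x mulr1 [peval 'X_i _]mevalXU subrr.
have two i j : tvec_ideal (shift l0 x i * shift l0 x j).
  apply: (@tvec_ideal_homog (1 + 1)); first exact: dhomogM.
    by rewrite pevalM sh0 mul0r.
  by rewrite peval_dirderM !sh0 mul0r mulr0 addr0.
rewrite !big_cons big_nil mulr1 mulrA.
exists (shift l0 x i1 * shift l0 x i2 * (shift l0 x i3 * shift l0 x i4)), 0.
by split; [apply: ideal_square_mul | apply: (ideal0 hI) | rewrite addr0].
Qed.

End Double.
End TangentVector.

(** * Linear forms on the doubled subscheme *)

Section Saturation.
Variables (R : realType) (N : nat).
Implicit Types (J : set (form R N)) (p q : form R N).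

(** A monomial of degree e is a multiple of one of degree d. *)
Lemma saturation_degree J p d e : is_ideal J -> (d <= e)%N ->
  (forall q, q \is d.-homog -> J (q * p)) -> forall q, q \is e.-homog -> J (q * p).
Proof.
move=> hJ /subnK <-; elim: (e - d)%N => [//|f IH] Jd q hq.
rewrite [q]mpolyE mulr_suml big_seq; apply: (ideal_sum _ hJ) => m qm.
have /= md := dhomog_mf hq qm.
have [i mi] : exists i, m i != 0%N.
  apply: contrapT => /forallNP no; have : mdeg m = 0%N.
    by rewrite mdegE big1 // => i _; apply/eqP; apply: contrapT => /negP; apply: no.
  by rewrite md.
have mE : (m - U_(i) + U_(i))%MM = m by rewrite submK // lep1mP.
rewrite -scalerAl; apply: (idealZ _ hJ); rewrite -mE mpolyXD mulrAC mulrC.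
apply: (idealMl _ hJ); apply: IH => //; rewrite dhomogX /=.
by have := mdegD (m - U_(i)) U_(i); rewrite mE md mdeg1 addn1 => -[->].
Qed.

Lemma saturation_lin J c p q : is_ideal J ->
  saturation J p -> saturation J q -> saturation J (c *: p + q).
Proof.
move=> hJ [d hp] [e hq]; exists (d + e)%N => r hr; rewrite mulrDr -scalerAr.
apply: (idealD hJ); first apply: (idealZ _ hJ).
  by apply: (saturation_degree hJ (leq_addr e d) hp).
by apply: (saturation_degree hJ (leq_addl d e) hq).
Qed.

End Saturation.

Lemma product_expand (A : comNzRingType) (a b x y w : A) :
  (a + (x + x) * w) * (b + (y + y) * w)
    - ((y + y) * (w * a + x * (w * w)) + (x + x) * (w * b + y * (w * w))) = a * b.
Proof. ring. Qed.

Lemma triple_expand (A : comNzRingType) (a b c x y z w : A) :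
  (a + x * w) * ((b + y * w) * (c + z * w)) - x * (y * z) * (w * (w * w)) =
  (c + z * w) * (a * b) + (c * b) * (x * w) + (a * c) * (y * w)
  + z * y * (a * (w * w)) + x * z * (b * (w * w)) + x * y * (c * (w * w)).
Proof. ring. Qed.

Section Terracini.
Variables (R : realType) (N n' : nat).
Local Notation C := R[i].
Local Notation n := n'.+1.
Variables (X : set (hcoord R N)) (x : hcoord R N) (T : {vspace 'rV[C]_N.+1}).
Hypotheses (cX : zariski_closed X) (Xx : X x).
Hypothesis TX : forall v, v \in T <-> tangent_cone X x v.

Lemma point_in_tangent_space : x \in T.
Proof.
apply/TX => p Ip; rewrite -peval_dirder [p]form_components dirder_sum peval_sum.
apply: big1 => d _; rewrite (peval_euler _ (pihomogP _ _ _)).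
by rewrite (vanishing_ideal_homogeneous cX d Ip Xx) mulr0.
Qed.

Variables (k : nat) (l0 : hcoord R N) (t b : 'I_n -> hcoord R N) (s : 'I_k -> hcoord R N).
Hypothesis fr : adapted_frame x T l0 t b s.
Variables (c2 : 'I_k -> 'I_n -> 'I_n -> C) (c3 : 'I_k -> 'I_n -> 'I_n -> 'I_n -> C).
Local Notation tl i := (linform (t i)).
Hypothesis expansion : forall j, local_ideal X x l0 4
  (linform (s j) - \sum_i \sum_h c2 j i h *: (tl i * tl h)
    - \sum_i \sum_h \sum_g c3 j i h g *: (tl i * (tl h * tl g))).

(** The matrix whose rows are the second fundamental form II(v, e_i), and the
    cubic term of the expansion along v. *)
Definition osculating_matrix (i : 'I_n.+1) (j : 'I_k) : form R n' :=
  if unlift ord_max i is Some i' then \sum_h (c2 j i' h + c2 j h i') *: 'X_h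
  else \sum_i \sum_h \sum_g c3 j i h g *: ('X_i * ('X_h * 'X_g)).

Definition osculating_degree (i : 'I_n.+1) : nat :=
  if unlift ord_max i is Some _ then 1 else 3.

Lemma osculating_matrix_homog i j : osculating_matrix i j \is (osculating_degree i).-homog.
Proof.
rewrite /osculating_matrix /osculating_degree; have X1 h : ('X_h : form R n') \is 1.-homog.
  by rewrite dhomogX /= mdeg1.
case: unlift => [i'|]; first by apply: rpred_sum => h _; apply: rpredZ.
do 3 apply: rpred_sum => ? _; apply: rpredZ.
by apply: (@dhomogM _ _ _ 1 _ 2) => //; apply: (@dhomogM _ _ _ 1 _ 1).
Qed.

Variable v : hcoord R n'.

Definition direction : hcoord R N := \sum_i v ord0 i *: b i.
Local Notation V := direction.

Lemma dot_l0_direction : dot l0 V = 0.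
Proof. by rewrite dot_sumr big1 // => i _; rewrite dotZr (frame_l0b fr) mulr0. Qed.

Lemma dot_t_direction i : dot (t i) V = v ord0 i.
Proof.
rewrite dot_sumr (bigD1 i) //= big1 => [|j ji].
  by rewrite dotZr (frame_tb fr) eqxx mulr1 addr0.
by rewrite dotZr (frame_tb fr) eq_sym (negPf ji) mulr0.
Qed.

Lemma direction_tangent : tangent_cone X x V.
Proof.
by apply/TX; apply: rpred_sum => i _; apply: rpredZ; apply: (frame_bT fr).
Qed.

Variable tau : hcoord R N.
Hypotheses (taux : dot tau x = 0) (tauV : dot tau V = 1).
Local Notation S := (tvec_scheme V (frame_l0x fr)).
Local Notation D := (double_chart x V l0 X).
Local Notation tt := (linform tau).

Let hD : is_ideal D := double_chart_ideal x V l0 X.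

(** With t_i = lam_i + v_i tau, the lam_i and tau^2 are in the ideal of the
    subscheme, hence lam_i lam_h and lam_i tau^2 are in its square.  What is left
    of the expansions of the s_j are the terms in tau lam_i, tau^2 and tau^3, whose
    coefficients are combinations of the entries of the matrix. *)
Lemma osculating_membership (a : 'I_k -> C) :
  (forall i, \sum_j a j * peval (osculating_matrix i j) v = 0) ->
  D (\sum_j a j *: linform (s j)).
Proof.
move=> aM; have [lam lamE] : exists lam, forall i, lam i = tl i - v ord0 i *: tt.
  by exists (fun i => tl i - v ord0 i *: tt).
have tE i : tl i = lam i + v ord0 i *: tt by rewrite lamE subrK.
have lam1 i : lam i \is 1.-homog.
  by rewrite lamE; apply: rpredB; [|apply: rpredZ]; apply: linform_homog.
have lamS i : tvec_ideal x V (lam i).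
  apply: (tvec_ideal_homog (lam1 i)).
    by rewrite lamE pevalB pevalZ !peval_linform (frame_tx fr) taux mulr0 subrr.
  rewrite lamE dirderB dirderZ pevalB pevalZ !dirder_linform ![peval _%:MP _]mevalC.
  by rewrite dot_t_direction tauV mulr1 subrr.
have ttS : tvec_ideal x V (tt * tt).
  apply: (@tvec_ideal_homog _ _ _ _ (1 + 1)).
  - by apply: dhomogM; apply: linform_homog.
  - by rewrite pevalM peval_linform taux mul0r.
  - by rewrite peval_dirderM peval_linform taux mul0r mulr0 addr0.
have DS p q : tvec_ideal x V p -> tvec_ideal x V q -> D (p * q).
  exact: double_chart_square.
(* Halving v_i compensates for the quadratic term along v being counted twice in
   the sum of the m i j *: E i. *)
have [E EE] : exists E, forall i, E i = tt * lam i + (v ord0 i / 2) *: (tt * tt).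
  by exists (fun i => tt * lam i + (v ord0 i / 2) *: (tt * tt)).
pose m i j : C := \sum_h (c2 j i h + c2 j h i) * v ord0 h.
have mE i j : peval (osculating_matrix (lift ord_max i) j) v = m i j.
  rewrite /osculating_matrix liftK peval_sum; apply: eq_bigr => h _.
  by rewrite pevalZ [peval 'X_h _]mevalXU.
pose m3 j : C := \sum_i \sum_h \sum_g c3 j i h g * (v ord0 i * (v ord0 h * v ord0 g)).
have m3E j : peval (osculating_matrix ord_max j) v = m3 j.
  rewrite /osculating_matrix unlift_none !peval_sum; apply: eq_bigr => i _.
  rewrite peval_sum; apply: eq_bigr => h _; rewrite peval_sum; apply: eq_bigr => g _.
  by rewrite pevalZ !pevalM ![peval 'X_ _ _]mevalXU.
have quad j : D (\sum_i \sum_h c2 j i h *: (tl i * tl h) - \sum_i m i j *: E i).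
  have -> : \sum_i m i j *: E i =
      \sum_i \sum_h c2 j i h *: (v ord0 h *: E i + v ord0 i *: E h).
    transitivity (\sum_i \sum_h (c2 j i h * v ord0 h) *: E i
                  + \sum_i \sum_h (c2 j h i * v ord0 h) *: E i).
      rewrite -big_split; apply: eq_bigr => i _ /=; rewrite -big_split scaler_suml.
      by apply: eq_bigr => h _ /=; rewrite -scalerDl mulrDl.
    rewrite [X in _ + X]exchange_big -big_split; apply: eq_bigr => i _ /=.
    rewrite -big_split; apply: eq_bigr => h _ /=.
    by rewrite scalerDr !scalerA.
  rewrite -sumrB; apply: (ideal_sum _ hD) => i _; rewrite -sumrB; apply: (ideal_sum _ hD) => h _.
  rewrite -scalerBr; apply: (idealZ _ hD).
  have := DS _ _ (lamS i) (lamS h); congr (D _); symmetry.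
  have vE l : (v ord0 l)%:MP = (v ord0 l / 2)%:MP + (v ord0 l / 2)%:MP :> form R N.
    by rewrite -mpolyCD -splitr.
  by rewrite !EE (tE i) (tE h) -!mul_mpolyC !vE; apply: product_expand.
have cub j : D (\sum_i \sum_h \sum_g c3 j i h g *: (tl i * (tl h * tl g))
    - m3 j *: (tt * (tt * tt))).
  rewrite scaler_suml -sumrB; apply: (ideal_sum _ hD) => i _.
  rewrite scaler_suml -sumrB; apply: (ideal_sum _ hD) => h _.
  rewrite scaler_suml -sumrB; apply: (ideal_sum _ hD) => g _.
  rewrite -scalerA -scalerBr; apply: (idealZ _ hD).
  rewrite (tE i) (tE h) (tE g) -!mul_mpolyC !mpolyCM.
  have Dr p q : D q -> D (p * q) by apply: (idealMl p hD).
  have Dl p q : D p -> D (p * q) by apply: (idealMr q hD).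
  rewrite triple_expand.
  exact: (idealD hD (idealD hD (idealD hD (idealD hD (idealD hD
    (Dr _ _ (DS _ _ (lamS i) (lamS h))) (Dl _ _ (DS _ _ (lamS g) (lamS h))))
    (Dl _ _ (DS _ _ (lamS i) (lamS g)))) (Dr _ _ (DS _ _ (lamS i) ttS)))
    (Dr _ _ (DS _ _ (lamS h) ttS))) (Dr _ _ (DS _ _ (lamS g) ttS))).
have exp j : D (linform (s j) - \sum_i m i j *: E i - m3 j *: (tt * (tt * tt))).
  have [i [h [q [Ii m4 e]]]] := expansion j.
  have : D (i + h * (linform l0 - 1) + q).
    apply: (idealD hD); last exact: (double_chart_mpow4 (frame_l0x fr) dot_l0_direction).
    apply: (idealD hD); first exact: double_chart_eqn.
    by apply: (idealMl _ hD); apply: double_chart_unit.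
  rewrite -e => /(idealD hD) /(_ (idealD hD (quad j) (cub j))).
  by congr (D _); ring.
have -> : \sum_j a j *: linform (s j) =
    \sum_j a j *: (linform (s j) - \sum_i m i j *: E i - m3 j *: (tt * (tt * tt))).
  transitivity (\sum_j a j *: linform (s j) - \sum_i (\sum_j a j * m i j) *: E i
                - (\sum_j a j * m3 j) *: (tt * (tt * tt))).
    have -> : \sum_j a j * m3 j = 0.
      by rewrite -[RHS](aM ord_max); apply: eq_bigr => j _; rewrite m3E.
    rewrite scale0r subr0 [X in _ - X]big1 ?subr0 // => i _.
    rewrite (_ : \sum_j _ = 0) ?scale0r //.
    by rewrite -[RHS](aM (lift ord_max i)); apply: eq_bigr => j _; rewrite mE.
  under [X in _ - X - _]eq_bigr => i _ do rewrite scaler_suml.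
  rewrite exchange_big scaler_suml -!sumrB; apply: eq_bigr => j _.
  rewrite !scalerBr scalerA; congr (_ - _ - _).
  by rewrite scaler_sumr; apply: eq_bigr => i _; rewrite scalerA.
by apply: (ideal_sum _ hD) => j _; apply: (idealZ _ hD).
Qed.

End Terracini.

(** * The lower bound *)

Section Bound.
Variable R : realType.
Local Notation C := R[i].

Lemma linform_inj N (a : hcoord R N) : linform a = 0 -> a = 0.
Proof.
move=> a0; apply/rowP => i; rewrite mxE.
have := peval_linform a (delta_mx ord0 i); rewrite a0 peval0 /dot (bigD1 i) //= big1.
  by rewrite mxE !eqxx mulr1 addr0.
by move=> j ji; rewrite mxE eqxx (negPf ji) mulr0.
Qed.

(** The image of A lies in the hyperplane orthogonal to y. *)
Lemma dim_dependent_system n k (A : 'M[C]_(k, n.+1)) (y : 'rV[C]_n.+1) :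
  y != 0 -> (forall j, \sum_i y ord0 i * A j i = 0) ->
  exists2 U : {vspace 'rV[C]_k}, forall a, a \in U -> a *m A = 0 & (k <= \dim U + n)%N.
Proof.
move=> y0 yA; pose f := linfun (mulmxr A : {linear 'rV[C]_k -> 'rV[C]_n.+1}).
exists (lker f) => [a|]; first by rewrite memv_ker lfunE => /eqP.
have := limg_ker_dim f fullv; rewrite capfv dimvf /dim /= mul1n => dk.
rewrite -[leqLHS]dk leq_add2l -ltnS; have : (\dim (limg f) <= n.+1)%N.
  by have := dimvS (subvf (limg f)); rewrite dimvf /dim /= mul1n.
rewrite leq_eqVlt => /orP[/eqP full|//].
have limgT : limg f = fullv.
  by apply/eqP; rewrite eqEdim subvf dimvf /dim /= mul1n full.
case/eqP: y0; apply/rowP => i; rewrite mxE.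
have : (delta_mx ord0 i : 'rV[C]_n.+1) \in limg f by rewrite limgT memvf.
case/memv_imgP => a _; rewrite lfunE /= => e.
have : \sum_l y ord0 l * (a *m A) ord0 l = 0.
  under eq_bigr => l _ do rewrite mxE mulr_sumr.
  rewrite exchange_big big1 //= => j _.
  under eq_bigr => l _ do rewrite mulrCA.
  by rewrite -mulr_sumr yA mulr0.
rewrite -e (bigD1 i) //= big1 => [|l li]; last by rewrite mxE eqxx (negPf li) mulr0.
by rewrite mxE !eqxx mulr1 addr0.
Qed.

(** The relations among the columns of the osculating matrix give at least k - n
    independent linear forms vanishing on 2S, where k + n = N. *)
Lemma terracini_nonempty N n (X : set (hcoord R N)) (x : hcoord R N)
    (T : {vspace 'rV[C]_N.+1}) : zariski_closed X -> X x ->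
    (forall v, v \in T <-> tangent_cone X x v) -> \dim T = n.+1 -> (N < 3 * n)%N ->
  exists S, in_terracini2 X n S.
Proof.
case: n => [|n'] // cX Xx TX dT Nn; set n := n'.+1 in dT Nn *.
have x0 : x != 0 by case: cX Xx => A _ -> [].
have xT := point_in_tangent_space cX Xx TX.
have [k [l0 [t [b [s [kn fr]]]]]] := adapted_frame_exists x0 xT dT.
have [c2 /choice[c3 expansion]] := choice (normal_expansion Xx TX fr).
have e_gt0 i : (0 < osculating_degree (n' := n') i)%N.
  by rewrite /osculating_degree; case: unlift.
have kn' : (k <= n' + n)%N by move: Nn kn; rewrite /n; lia.
have [v [y [v0 y0 yM]]] :=
  determinantal_locus_nonempty e_gt0 (osculating_matrix_homog c2 c3) kn'.
have [i0 vi0] : exists i, v ord0 i != 0.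
  apply: contrapT => /forallNP no; case/eqP: v0; apply/rowP => i; rewrite mxE.
  by apply/eqP; apply: contrapT => /negP; apply: no.
(* A linear form that vanishes at x and is 1 on the direction. *)
pose tau := (v ord0 i0)^-1 *: t i0.
have taux : dot tau x = 0 by rewrite dotZl (frame_tx fr) mulr0.
have tauV : dot tau (direction b v) = 1.
  by rewrite dotZl (dot_t_direction fr) mulVf.
have l0V := dot_l0_direction fr v.
pose S := tvec_scheme (direction b v) (frame_l0x fr).
pose A := \matrix_(j < k, i < n.+1) peval (osculating_matrix c2 c3 i j) v.
have [|U UA dU] := @dim_dependent_system n k A y y0.
  by move=> j; rewrite -[RHS](yM j); apply: eq_bigr => i _; rewrite mxE.
have hJ : is_ideal (ideal_add (ideal_square (sideal S)) (vanishing_ideal X)).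
  apply: ideal_add_ideal; last exact: vanishing_ideal_ideal.
  exact/ideal_square_ideal/sideal_ideal.
have [||W WP] := @subspace_vspace _ (linear_forms R N)
    (fun l : dhomog N.+1 C 1 => double_ideal X S l).
- by exists 0%N => q _; rewrite mulr0; apply: (ideal0 hJ).
- by move=> c p q; apply: saturation_lin.
exists S; split.
- exact: (tvec_scheme_length (frame_l0x fr) l0V taux tauV).
- exact: (tvec_scheme_of (frame_l0x fr) cX Xx (direction_tangent TX fr v)).
exists W => //.
pose F (a : 'rV[C]_k) : hcoord R N := \sum_j a ord0 j *: s j.
pose phi (a : 'rV[C]_k) : linear_forms R N := DHomog (linform_homog (F a)).
have phi_lin : linear phi.
  move=> c a a'; apply: val_inj; rewrite /= !linform_sum scaler_sumr -big_split.
  by apply: eq_bigr => j _ /=; rewrite !mxE scalerDl scalerA.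
pose phiL : {linear 'rV[C]_k -> linear_forms R N} :=
  HB.pack phi (GRing.isLinear.Build _ _ _ _ phi phi_lin).
pose f := linfun phiL.
have f_inj : (U :&: lker f)%VS = 0%VS.
  apply/eqP; rewrite -subv0; apply/subvP => a; rewrite memv_cap memv0 memv_ker lfunE /=.
  case/andP=> _ /eqP/(congr1 (@mpoly_of_dhomog _ _ _)) /= /linform_inj fa.
  by apply/eqP/rowP => j; rewrite mxE; apply: (frame_free fr fa).
have imgW : (f @: U <= W)%VS.
  apply/subvP => _ /memv_imgP[a /UA/rowP aA ->]; rewrite lfunE; apply/WP => /=.
  apply: (double_chart_sound (frame_l0x fr) cX (linform_homog (F a))).
  rewrite linform_sum; apply: (osculating_membership fr expansion taux tauV) => i.
  by have := aA i; rewrite !mxE => e; rewrite -[RHS]e; apply: eq_bigr => j _; rewrite mxE.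
have dimW := dimvS imgW; rewrite limg_dim_eq // in dimW.
rewrite dimvf /dim /= add1n bin1.
have bound w : (k <= w + n -> N.+1 < w + (2 * n + 2))%N by lia.
by apply: bound; apply: leq_trans dU _; rewrite leq_add2r.
Qed.

End Bound.

Theorem corollary2p6 (R : realType) (M n : nat) (X : set (hcoord R M))
    (hX : smooth_variety X n) (m : nat) (hm : is_msdim X m) :
  (3 * n <= m)%N.
Proof.
have [[cX _] dX _] := hX; have [[f fe [n' [[cY [[y Yy] _]] dY sm] noS]] _] := hm.
rewrite (embedding_dim cX fe dX dY) leqNgt; apply/negP => lt.
have [T dT TY] := sm y Yy.
by apply: noS; apply: terracini_nonempty cY Yy TY dT lt.
Qed.
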